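(* Let $T_1\subseteq\mathbb{R}^2$ be a maximal lattice-free triangle of type 1 and let $T_2\subseteq\mathbb{R}^2$ be a rational maximal lattice-free triangle of type 2, and put $w:=w(T_2)$. Then for every $z>1$: (I) $$P^{T_1}(z)=\begin{cases}0 & \text{if } 1<z\le \tfrac32,\\ \tfrac34\left(\tfrac{2z-3}{z-1}\right)^2 & \text{if } \tfrac32<z<2,\\ 1 & \text{if } 2\le z<+\infty;\end{cases}$$ (II) $$P^{T_2}(z)\ge\begin{cases}0 & \text{if } 1<z\le w,\\ g_1 & \text{if } w<z\le \tfrac{w}{w-1},\\ g_1+g_2 & \text{if } \tfrac{w}{w-1}<z<+\infty,\end{cases}$$ where $g_1=\frac{(z-w)(2wz-w-z)}{w^2(z-1)^2}$ and $g_2=\frac{(w-1)^2(z-1)^2-1}{w^2(z-1)^2}$.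
   Context: A closed convex set $B\subseteq\mathbb{R}^2$ with non-empty interior is lattice-free if its interior contains no point of $\mathbb{Z}^2$, and maximal lattice-free if it is not properly contained in another lattice-free closed convex set. A type 1 triangle is a triangle with integer vertices and exactly one integer point in the relative interior of each edge. A type 2 triangle is a triangle with at least one non-integral vertex $v$, exactly one integer point in the relative interior of each of the two edges incident to $v$, and at least two integer points on the third edge. A split is a set $\{x\in\mathbb{R}^2: b\le a_1x_1+a_2x_2\le b+1\}$ with $a_1,a_2$ coprime integers and $b\in\mathbb{Z}$. For $f\in\mathbb{R}^2$ and rays $r^1,\dots,r^n\in\mathbb{R}^2\setminus\{0\}$ let $R_f^n:=\mathrm{conv}\{s\in\mathbb{R}^n_+: f+\sum_{j=1}^n r^js_j\in\mathbb{Z}^2\}$. For a lattice-free polyhedron $B$ with $f$ in its interior, let $\psi^B$ be the Minkowski functional of $B-f$, i.e. $\psi^B(r)=\min\{\lambda>0: r\in\lambda(B-f)\}$ (taken as $0$ if $r\in\lambda(B-f)$ for all $\lambda>0$); the cut associated with $B$ is $\sum_j\psi^B(r^j)s_j\ge1$. Let $\mathcal S$ be the set of all splits containing $f$ in their interior. For a set $\mathcal L$ of such polyhedra, $\mathcal L(R_f^n)$ denotes the set of $s\in\mathbb{R}^n$ with $s_j\ge0$ for all $j$ satisfying the cuts associated with all members of $\mathcal L$; $\mathcal S(R_f^n)$ is the split closure. For polyhedra $P\subseteq Q\subseteq\mathbb{R}^n_+$ with $P$ of covering type, $\alpha P:=\{x:\alpha x\in P\}$ for $\alpha\in(0,\infty)$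 and $\alpha P:=\mathbb{R}^n_+$ for $\alpha=+\infty$; the strength $t(P,Q)$ is the minimum $\alpha\ge1$ with $Q\subseteq\alpha P$. For a maximal lattice-free triangle $B$ with vertices $v^1,v^2,v^3$ and $f\in\mathrm{int}(B)$, take $n=3$ and the corner rays $r^j=v^j-f$, and set $\mathcal F=\mathcal S\cup\{B\}$. Define $$P^B(z):=\frac{1}{\mathrm{Area}(B)}\int_{f\in\mathrm{int}(B)}\mathbf 1\{t(\mathcal F(R_f^3),\mathcal S(R_f^3))\le z\}\,df,$$ i.e. the probability, for $f$ uniform in the interior of $B$, that the strength of adding the cut from $B$ to the split closure is at most $z$. The lattice width of $B$ is $w(B):=\min_{u\in\mathbb{Z}^2\setminus\{0\}}\left(\max_{x\in B}u^Tx-\min_{x\in B}u^Tx\right)$. *)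

(* Defs.v *)
From HB Require Import structures.
From mathcomp Require Import all_boot all_order all_algebra.
From mathcomp Require Import all_classical all_reals all_analysis.
Set Implicit Arguments. Unset Strict Implicit. Unset Printing Implicit Defensive.
Import Order.TTheory GRing.Theory Num.Theory.
Import numFieldNormedType.Exports.
Local Open Scope classical_set_scope.
Local Open Scope ring_scope.

Section Defs.
Variable R : realType.
Implicit Types (p q u v f r : R * R) (B : set (R * R)).

Definition padd p q : R * R := (p.1 + q.1, p.2 + q.2).
Definition psub p q : R * R := (p.1 - q.1, p.2 - q.2).
Definition pscale (t : R) p : R * R := (t * p.1, t * p.2).
Definition dot p q : R := p.1 * q.1 + p.2 * q.2.

Definition is_int (x : R) : Prop := exists k : int, x = k%:~R.
Definition is_lattice p : Prop := is_int p.1 /\ is_int p.2.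
Definition is_rat (x : R) : Prop := exists q : rat, x = ratr q.
Definition is_rat_pt p : Prop := is_rat p.1 /\ is_rat p.2.

Definition convex_set B : Prop :=
  forall x y (t : R), B x -> B y -> 0 <= t <= 1 ->
    B (padd (pscale (1 - t) x) (pscale t y)).

Definition lattice_free B : Prop :=
  closed B /\ convex_set B /\ interior B !=set0 /\
  forall p, is_lattice p -> ~ interior B p.

Definition maximal_lattice_free B : Prop :=
  lattice_free B /\ forall B', lattice_free B' -> B `<=` B' -> B' = B.

Definition nondegenerate v1 v2 v3 : Prop :=
  (v2.1 - v1.1) * (v3.2 - v1.2) - (v2.2 - v1.2) * (v3.1 - v1.1) != 0.

Definition triangle v1 v2 v3 : set (R * R) :=
  [set x | exists a b c : R, [/\ 0 <= a, 0 <= b, 0 <= c, a + b + c = 1 &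
     x = padd (padd (pscale a v1) (pscale b v2)) (pscale c v3)]].

Definition segment u v : set (R * R) :=
  [set x | exists t : R, 0 <= t <= 1 /\ x = padd (pscale (1 - t) u) (pscale t v)].
Definition open_segment u v : set (R * R) :=
  [set x | exists t : R, 0 < t < 1 /\ x = padd (pscale (1 - t) u) (pscale t v)].

Definition one_lattice_pt_in_relint u v : Prop :=
  exists! p, is_lattice p /\ open_segment u v p.

Definition type1 v1 v2 v3 : Prop :=
  [/\ nondegenerate v1 v2 v3,
      is_lattice v1, is_lattice v2, is_lattice v3 &
      [/\ one_lattice_pt_in_relint v1 v2, one_lattice_pt_in_relint v2 v3 &
          one_lattice_pt_in_relint v3 v1]].

Definition type2_at v a b : Prop :=
  [/\ ~ is_lattice v, one_lattice_pt_in_relint v a, one_lattice_pt_in_relint v b &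
      exists p q, [/\ p <> q, is_lattice p, is_lattice q, segment a b p & segment a b q]].

Definition type2 v1 v2 v3 : Prop :=
  nondegenerate v1 v2 v3 /\
  (type2_at v1 v2 v3 \/ type2_at v2 v3 v1 \/ type2_at v3 v1 v2).

Definition rational_triangle v1 v2 v3 : Prop :=
  [/\ is_rat_pt v1, is_rat_pt v2 & is_rat_pt v3].

Definition split_set (a1 a2 b : int) : set (R * R) :=
  [set x | b%:~R <= a1%:~R * x.1 + a2%:~R * x.2 <= b%:~R + 1].

Definition is_split B : Prop :=
  exists a1 a2 b : int, gcdz a1 a2 = 1%N /\ B = split_set a1 a2 b.

(* Minkowski functional of B - f: inf { lambda > 0 | r \in lambda (B - f) }
   (= 0 when every lambda > 0 works) *)
Definition minkowski B f r : R :=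
  inf [set lam : R | 0 < lam /\ exists x, B x /\ r = pscale lam (psub x f)].

Definition nonneg3 (s : 'I_3 -> R) : Prop := forall j, 0 <= s j.

Definition cut_holds B f (rays : 'I_3 -> R * R) (s : 'I_3 -> R) : Prop :=
  1 <= \sum_(j < 3) minkowski B f (rays j) * s j.

Definition closure_of (L : set (R * R) -> Prop) f (rays : 'I_3 -> R * R)
  : set ('I_3 -> R) :=
  [set s | nonneg3 s /\ forall B, L B -> cut_holds B f rays s].

Definition splits_at f (B : set (R * R)) : Prop := is_split B /\ interior B f.

Definition split_closure f rays := closure_of (splits_at f) f rays.

Definition split_plus_closure T f rays :=
  closure_of (fun B => splits_at f B \/ B = T) f rays.

(* alpha P, with +oo P = R^n_+ *)
Definition scale_set (alpha : \bar R) (P : set ('I_3 -> R)) : set ('I_3 -> R) :=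
  match alpha with
  | r%:E => [set x | P (fun j => r * x j)]
  | _ => [set x | nonneg3 x]
  end.

Definition strength (P Q : set ('I_3 -> R)) : \bar R :=
  ereal_inf [set alpha : \bar R | (1%:E <= alpha)%E /\ Q `<=` scale_set alpha P].

Definition corner_rays v1 v2 v3 f : 'I_3 -> R * R :=
  fun j => match val j with
           | 0%N => psub v1 f
           | 1%N => psub v2 f
           | _ => psub v3 f
           end.

Definition area (A : set (R * R)) : \bar R :=
  ((@lebesgue_measure R) \x (@lebesgue_measure R))%E A.

Definition probP v1 v2 v3 (z : R) : \bar R :=
  let B := triangle v1 v2 v3 in
  (area [set f | interior B f /\
     (strength (split_plus_closure B f (corner_rays v1 v2 v3 f))
               (split_closure f (corner_rays v1 v2 v3 f)) <= z%:E)%E]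
   * (fine (area B))^-1%:E)%E.

Definition lattice_width B : R :=
  inf [set d : R | exists u1 u2 : int, (u1, u2) != (0, 0) /\
     d = sup [set dot (u1%:~R, u2%:~R) x | x in B]
         - inf [set dot (u1%:~R, u2%:~R) x | x in B]].

End Defs.

(* Main.v *)
Require Import Defs.
From HB Require Import structures.
From mathcomp Require Import all_boot all_order all_algebra.
From mathcomp Require Import all_classical all_reals all_analysis.
From mathcomp Require Import ring lra measurable_realfun.
Set Implicit Arguments.
Unset Strict Implicit.
Unset Printing Implicit Defensive.
Import Order.TTheory GRing.Theory Num.Theory.
Import numFieldNormedType.Exports.
Local Open Scope classical_set_scope.
Local Open Scope ring_scope.

(* With the corner rays of a triangle [T], the cut of [T] is [s1 + s2 + s3 >= 1],
   so the strength at [f] is at most [z] iff [z * (s1 + s2 + s3) >= 1] on the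
   split closure.  Everything is expressed in the barycentric coordinates
   [l1, l2, l3] of [f], which turn areas into multiples of the area of [T].

   Type 1: every lattice point has half-integral barycentric coordinates, so
   each [2 * l_j] is an integral functional and defines splits.  Those with
   [l_j < 1/2] give the upper bound on the strength.  It is attained at an
   explicit point ([s_j = 1/2 - l_j], or a point of the face [s_1 = 0] if
   [l_1 >= 1/2]) which satisfies all split cuts.  Hence the strength is 2 on the
   medial triangle and [1 + 1 / (2 * l_1)] on the corner [l_1 >= 1/2].

   Type 2: in unimodular coordinates [X, Y] the third edge lies on [Y = 0] from
   [X = - l] to [X = 1 + r], the two other edges pass through (0, 1) and (1, 1),
   and the apex has height [h] with [(l + r) * (h - 1) = 1].  The base then has
   length [h / (h - 1)], and the lattice width is the smaller of these two
   numbers.  One split suffices: [0 <= Y <= 1] works if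
   [Y <= 1 - (h - 1) / (z - 1)], and [0 <= X <= 1] works if
   [l <= (z - 1) * X] and [r <= (z - 1) * (1 - X)].  The points where both fail
   form two triangles, whose total area is computed. *)

(** * Affine changes of variables for planar Lebesgue measure *)

Section PlaneArea.
Context {R : realType}.
Local Notation leb := (@lebesgue_measure R).
Local Notation T1 := (measurableTypeR R).

(** Rescaled by [|d|], the push-forward of Lebesgue measure along [h] agrees with Lebesgue measure
    on the intervals []a, b]], and these determine the measure. *)
Lemma lebesgue_affine (d e : R) (A : set T1) : d != 0 -> measurable A ->
  leb [set y | A (d * y + e)] = (`|d|^-1%:E * leb A)%E.
Proof.
move=> d0 mA.
pose h (y : T1) : T1 := d * y + e.
have mh : measurable_fun setT h.
  apply: continuous_measurable_fun => x; apply: cvgD; [apply: cvgM; [exact: cvg_cst|exact: cvg_id]|exact: cvg_cst].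
have [mu muE] : exists mu : {measure set T1 -> \bar R}, forall B, mu B = (`|d|%:E * leb (h @^-1` B))%E.
  have [nu nuE] : exists nu : {measure set T1 -> \bar R}, forall B, nu B = leb (h @^-1` B).
    by exists (measure_function_pushforward__canonical__measure_function_Measure leb mh).
  by exists (mscale (NngNum (normr_ge0 d)) nu) => B; rewrite -nuE.
have -> : leb A = mu A.
  apply: lebesgue_measure_unique => //= _ [[a b]] _ <-.
  rewrite muE.
  have [d_gt0|d_lt0|d00] := ltgtP 0 d; last by rewrite -d00 eqxx in d0.
    have -> : h @^-1` `]a, b] = `](a - e) / d, (b - e) / d]%classic.
      apply/seteqP; split => y /=; rewrite !in_itv/= /h ltr_pdivrMr// ler_pdivlMr// => /andP[? ?]; apply/andP; split; nra.
    rewrite !lebesgue_measure_itv/= !lte_fin ltr_pM2r ?invr_gt0// ltrD2r.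
    case: ifPn; rewrite ?mule0// => _.
    by rewrite -!EFinB -EFinM gtr0_norm//; congr EFin; field; lra.
  (* A negative slope exchanges the two ends, so the preimage is open on the right. *)
  have -> : h @^-1` `]a, b] = `[(b - e) / d, (a - e) / d[%classic.
    apply/seteqP; split => y /=; rewrite !in_itv/= /h ltr_ndivlMr// ler_ndivrMr// => /andP[? ?]; apply/andP; split; nra.
  rewrite !lebesgue_measure_itv/= !lte_fin ltr_nM2r ?invr_lt0// ltrD2r.
  case: ifPn; rewrite ?mule0// => _.
  by rewrite -!EFinB -EFinM ltr0_norm//; congr EFin; field; lra.
rewrite muE muleA -EFinM mulVf ?normr_eq0// mul1e.
by [].
Qed.

(** Holds for arbitrary sets: sections are compared by outer measure, and the integral is a supremum
    over simple functions below them. Sets defined through the strength can thus be bounded by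
    explicit ones. *)
Lemma le_area (A B : set (R * R)) : A `<=` B -> (area A <= area B)%E.
Proof.
move=> AB; rewrite /area /product_measure1 !ge0_integralTE//.
apply: le_ereal_sup => _ [h hA <-]; exists h => // x.
by rewrite (le_trans (hA x))//=; apply: le_outer_measure => y; rewrite /xsection/= !inE; exact: AB.
Qed.

(** On each vertical section the map is affine of slope [d]; the term [c * x.1] only translates the
    section. *)
Lemma area_shear (c d e : R) (A : set (T1 * T1)) : d != 0 -> measurable A ->
  area [set x | A (x.1, c * x.1 + d * x.2 + e)] = (`|d|^-1%:E * area A)%E.
Proof.
move=> d0 mA; rewrite /area /product_measure1.
rewrite -ge0_integralZl//=; last exact: measurable_fun_xsection.
apply: eq_integral => x _ /=.
rewrite -(@lebesgue_affine d (c * x + e))//; last exact: measurable_xsection.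
congr (leb _); apply/seteqP; split => y; rewrite /xsection/= !inE/=.
  by rewrite (_ : d * y + (c * x + e) = c * x + d * y + e)//; ring.
by rewrite (_ : d * y + (c * x + e) = c * x + d * y + e)//; ring.
Qed.

(** Both orders of integration define a measure with the same values on rectangles, and such a
    measure is unique. *)
Lemma area_swap (A : set (T1 * T1)) : measurable A ->
  area [set x | A (x.2, x.1)] = area A.
Proof.
move=> mA.
have -> : area A = product_measure2 leb leb A.
  apply: (@product_measure_unique _ _ _ _ R leb leb (product_measure2 leb leb)) => // B C mB mC.
  exact: product_measure2E.
by apply: eq_integral => x _ /=; congr (leb _).
Qed.

Lemma measurable_affine (a b c a' b' c' : R) (A : set (T1 * T1)) :
  measurable A ->
  measurable ([set x | A (a * x.1 + b * x.2 + c, a' * x.1 + b' * x.2 + c')] : set (T1 * T1)).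
Proof.
move=> mA; rewrite -[X in measurable X]setTI.
have maff (p q r : R) : measurable_fun setT (fun x : T1 * T1 => p * x.1 + q * x.2 + r : T1).
  apply: measurable_funD; last exact: measurable_cst.
  apply: measurable_funD; apply: measurable_funM; by [exact: measurable_cst|exact: measurable_fst|exact: measurable_snd].
by apply: (measurable_fun_pair (maff a b c) (maff a' b' c')).
Qed.

(* Factor the affine map into a shear of the second coordinate followed by one
   of the first. *)
Lemma area_affine (a b c a' b' c' : R) (A : set (T1 * T1)) :
  a * b' - b * a' != 0 -> measurable A ->
  area [set x | A (a * x.1 + b * x.2 + c, a' * x.1 + b' * x.2 + c')] =
  (`|a * b' - b * a'|^-1%:E * area A)%E.
Proof.
(* If [b'] vanishes then [b] does not, and exchanging the two output coordinates restores the
   assumption. *)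
wlog b'0 : a b c a' b' c' A / b' != 0.
  move=> hw D0 mA.
  have [b'0|] := eqVneq b' 0; last by move=> ?; exact: hw.
  have b0 : b != 0.
    by apply: contraNneq D0 => b0; rewrite b'0 b0 mulr0 mul0r subr0.
  rewrite -(area_swap mA) (_ : a * b' - b * a' = - (a' * b - b' * a)); last ring.
  have mA2 : measurable ([set y : T1 * T1 | A (y.2, y.1)] : set (T1 * T1)).
    have := measurable_affine 0 1 0 1 0 0 mA.
    by under eq_set do rewrite !(mul0r, mul1r, add0r, addr0).
  rewrite normrN -(hw a' b' c' a b c)//.
  by rewrite (_ : a' * b - b' * a = - (a * b' - b * a')) ?oppr_eq0//; ring.
move=> D0 mA.
set D := a * b' - b * a' in D0 *.
rewrite (_ : [set x | _] = [set x | [set y : T1 * T1 | A (D / b' * y.1 + b / b' * y.2 + (c - b * c' / b'), y.2)]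
   (x.1, a' * x.1 + b' * x.2 + c')]); last first.
  apply/seteqP; split => x /=; rewrite (_ : D / b' * x.1 + _ + _ = a * x.1 + b * x.2 + c)//;
  by rewrite /D; field.
have mA1 : measurable ([set y : T1 * T1 | A (D / b' * y.1 + b / b' * y.2 + (c - b * c' / b'), y.2)] : set (T1 * T1)).
  have := measurable_affine (D / b') (b / b') (c - b * c' / b') 0 1 0 mA.
  by under eq_set do rewrite !(mul0r, mul1r, add0r, addr0).
have mA2 : measurable ([set y : T1 * T1 | A (y.2, y.1)] : set (T1 * T1)).
  have := measurable_affine 0 1 0 1 0 0 mA.
  by under eq_set do rewrite !(mul0r, mul1r, add0r, addr0).
rewrite area_shear// -(area_swap mA1)/=.
rewrite (_ : [set x | _] = [set x | [set y : T1 * T1 | A (y.2, y.1)]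
   (x.1, b / b' * x.1 + D / b' * x.2 + (c - b * c' / b'))]); last first.
  by apply/seteqP; split => x /=; rewrite [b / b' * _ + _]addrC.
rewrite area_shear ?mulf_neq0 ?invr_eq0// area_swap// muleA -EFinM -invfM -normrM.
by congr (_%:E * _)%E; congr (`|_|^-1); field.
Qed.
End PlaneArea.

(** * Areas of the unit simplex and of right triangles *)

Section Simplex.
Context {R : realType}.
Local Notation T1 := (measurableTypeR R).
Local Notation "'P2'" := (T1 * T1)%type.

Lemma measurable_halfplane (a b c : R) :
  measurable ([set x | 0 < a * x.1 + b * x.2 + c] : set P2).
Proof.
have := @measurable_affine R a b c 0 0 0 (`]0, +oo[%classic `*` setT).
rewrite (_ : [set x | _] = [set x | 0 < a * x.1 + b * x.2 + c]).
  by apply; apply: measurableX => //; exact: measurable_itv.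
by apply/seteqP; split => x /=; rewrite in_itv/= andbT; tauto.
Qed.

Definition osimplex : set P2 := [set x | [/\ 0 < x.1, 0 < x.2 & x.1 + x.2 < 1]].
Definition csimplex : set P2 := [set x | [/\ 0 <= x.1, 0 <= x.2 & x.1 + x.2 <= 1]].

Lemma measurable_osimplex : measurable osimplex.
Proof.
have -> : osimplex = [set x | 0 < 1 * x.1 + 0 * x.2 + 0] `&`
   [set x | 0 < 0 * x.1 + 1 * x.2 + 0] `&` [set x | 0 < -1 * x.1 + -1 * x.2 + 1].
  by apply/seteqP; split => x /=; [move=> [? ? ?]|move=> [[? ?] ?]]; do ?split; lra.
by apply: measurableI; [apply: measurableI|]; exact: measurable_halfplane.
Qed.

Lemma measurable_csimplex : measurable csimplex.
Proof.
have -> : csimplex = ~` [set x | 0 < -1 * x.1 + 0 * x.2 + 0] `&`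
   ~` [set x | 0 < 0 * x.1 + -1 * x.2 + 0] `&` ~` [set x | 0 < 1 * x.1 + 1 * x.2 + -1].
  apply/seteqP; split => x /=.
    by move=> [? ? ?]; split; [split|]; apply/negP; rewrite -leNgt; lra.
  by move=> [[/negP + /negP +] /negP]; rewrite -!leNgt => *; split; lra.
by apply: measurableI; [apply: measurableI|]; apply: measurableC; exact: measurable_halfplane.
Qed.

Lemma area_rect (a b : R) : 0 <= a -> 0 <= b ->
  area (`]0, a[%classic `*` `]0, b[%classic) = (a * b)%:E.
Proof.
move=> a0 b0; rewrite /area product_measure1E//= !lebesgue_measure_itv/= !lte_fin.
rewrite EFinM; congr (_ * _)%E; case: ltP; rewrite ?sube0//.
  by move=> ?; congr EFin; lra.
by move=> ?; congr EFin; lra.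
Qed.

(** Kept as an abstract positive constant, since it cancels from the ratio of areas in [probP]. *)
Definition simplex_area : R := fine (area osimplex).

Lemma area_osimplex : area osimplex = simplex_area%:E.
Proof.
rewrite fineK// ge0_fin_numE; last exact: measure_ge0.
apply: (@le_lt_trans _ _ (area (`]0, 1[%classic `*` `]0, 1[%classic))).
  by apply: le_area => x [x1 x2 x12] /=; rewrite !in_itv/=; split; apply/andP; split; lra.
by rewrite area_rect// ltry.
Qed.

Lemma simplex_area_gt0 : 0 < simplex_area.
Proof.
rewrite -lte_fin -area_osimplex.
apply: (@lt_le_trans _ _ (area (`]0, 2^-1[%classic `*` `]0, 2^-1[%classic))).
  by rewrite area_rect ?lte_fin ?invr_ge0// mulr_gt0// invr_gt0.
apply: le_area => x /= []; rewrite !in_itv/= => /andP[? ?] /andP[? ?].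
by split; lra.
Qed.

(** Rescaling the legs [c / p] and [c / q] to unit length carries this triangle onto [osimplex]. *)
Lemma area_right_triangle (p q c t s : R) : 0 < p -> 0 < q -> 0 < c ->
  area [set x | [/\ t < x.1, s < x.2 & p * (x.1 - t) + q * (x.2 - s) < c]] =
  (c ^+ 2 / (p * q) * simplex_area)%:E.
Proof.
move=> p0 q0 c0.
have D : p / c * (q / c) - 0 * 0 != 0 by rewrite mulr0 subr0 !mulf_neq0 ?invr_eq0 ?gt_eqF.
have := area_affine (- (p * t / c)) (- (q * s / c)) D measurable_osimplex.
rewrite area_osimplex -EFinM (_ : `|_|^-1 = c ^+ 2 / (p * q)) => [<-|].
  congr area; apply: eq_set => x; rewrite /osimplex /=.
  have -> : p / c * x.1 + 0 * x.2 + - (p * t / c) = p / c * (x.1 - t) by field; lra.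
  have -> : 0 * x.1 + q / c * x.2 + - (q * s / c) = q / c * (x.2 - s) by field; lra.
  have -> : p / c * (x.1 - t) + q / c * (x.2 - s) =
    (p * (x.1 - t) + q * (x.2 - s)) / c by field; lra.
  have H u v : 0 < v -> (0 < v / c * u) = (0 < u) by move=> v0; rewrite pmulr_rgt0// divr_gt0.
  by rewrite ltr_pdivrMr// mul1r !H// !subr_gt0.
rewrite mulr0 subr0 gtr0_norm ?mulr_gt0 ?invr_gt0//; field; lra.
Qed.

(** The boundary is negligible: for every [e > 0] the closed simplex fits into an open right
    triangle with legs [1 + 3 * e]. *)
Lemma area_csimplex : area csimplex = simplex_area%:E.
Proof.
apply/eqP; rewrite eq_le; apply/andP; split; last first.
  by rewrite -area_osimplex; apply: le_area => x [? ? ?]; split; lra.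
have key e : 0 < e -> (area csimplex <= ((1 + 3 * e) ^+ 2 * simplex_area)%:E)%E.
  move=> e0; have e1 : 0 < 1 + 3 * e by lra.
  have := area_right_triangle (- e) (- e) ltr01 ltr01 e1.
  by rewrite mul1r divr1 => <-; apply: le_area => x /= [? ? ?]; split; lra.
have : area csimplex \is a fin_num.
  rewrite ge0_fin_numE; last exact: measure_ge0.
  by apply: (le_lt_trans (key 1 _)); rewrite ?ltry.
move=> /fineK; set c := fine _ => cE; rewrite -cE in key *.
rewrite lee_fin; apply/ler_addgt0Pr => e e0.
have k0 := simplex_area_gt0.
(* For [0 < d <= 1] one has [(1 + 3 * d) ^+ 2 <= 1 + 15 * d], so this choice keeps the excess area
   at most [e]. *)
have d0 : 0 < Num.min 1 (e / (15 * simplex_area)).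
  by rewrite lt_min ltr01 divr_gt0// mulr_gt0.
have := key _ d0; rewrite lee_fin; move: d0; set d := Num.min _ _ => d0 H.
have d1 : d <= 1 by rewrite ge_min lexx.
have : d <= e / (15 * simplex_area) by rewrite ge_min lexx orbT.
rewrite ler_pdivlMr ?mulr_gt0// => H2.
have : d * d * simplex_area <= d * simplex_area by rewrite ler_pM2r//; nra.
nra.
Qed.

(** The open and the closed corner are homothetic to the open and closed unit simplex with ratio
    [1 - t]; having equal areas, they determine that of every set in between. *)
Lemma area_corner_sandwich (t : R) (A : set P2) : t < 1 ->
  [set x | [/\ t < x.1, 0 < x.2 & x.1 + x.2 < 1]] `<=` A ->
  A `<=` [set x | [/\ t <= x.1, 0 <= x.2 & x.1 + x.2 <= 1]] ->
  area A = ((1 - t) ^+ 2 * simplex_area)%:E.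
Proof.
move=> t1 lA uA.
have s0 : 0 < 1 - t by lra.
apply/eqP; rewrite eq_le; apply/andP; split; last first.
  have := area_right_triangle t 0 ltr01 ltr01 s0.
  rewrite mul1r divr1 => <-; apply: le_area; apply: subset_trans lA => x /= [? ? ?].
  by split; lra.
have D : (1 - t)^-1 * (1 - t)^-1 - 0 * 0 != 0 by rewrite mulr0 subr0 mulf_neq0 ?invr_eq0 ?gt_eqF.
have := area_affine (- (t / (1 - t))) 0 D measurable_csimplex.
rewrite area_csimplex -EFinM (_ : `|_|^-1 = (1 - t) ^+ 2).
  move=> <-; apply: le_area; apply: (subset_trans uA) => x /= [? ? ?]; split => /=.
  - by rewrite mul0r addr0 mulrC -mulrBl mulr_ge0 ?invr_ge0//; lra.
  - by rewrite mul0r add0r addr0 mulr_ge0 ?invr_ge0//; lra.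
  - rewrite [X in X <= _](_ : _ = (x.1 + x.2 - t) / (1 - t)); last by field; lra.
    by rewrite ler_pdivrMr//; lra.
rewrite mulr0 subr0 gtr0_norm ?mulr_gt0 ?invr_gt0//; field; lra.
Qed.

End Simplex.

(** * Barycentric coordinates in the plane *)

Definition orient (R : realType) (u v w : R * R) : R :=
  (v.1 - u.1) * (w.2 - u.2) - (v.2 - u.2) * (w.1 - u.1).

(** Cramer's formula for the coordinate of [x] at the first vertex [u]. Rotating [u v w] gives the
    coordinates at [v] and [w]. *)
Definition bary (R : realType) (u v w x : R * R) : R := orient x v w / orient u v w.

Local Ltac orient_neq0 D :=
  apply: contraNneq D => /= ?; apply/eqP; rewrite /orient /=; lra.
Local Ltac bary_field D :=
  rewrite /bary /orient /=; field; repeat (apply/andP; split); orient_neq0 D.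

Section Barycentric.
Context {R : realType}.
Implicit Types (u v w x f d p : R * R).
Local Notation T1 := (measurableTypeR R).

Lemma orient_rot u v w : orient v w u = orient u v w.
Proof. by rewrite /orient; ring. Qed.

Lemma orient_rot_neq0 u v w : orient u v w != 0 -> orient v w u != 0.
Proof. by rewrite (orient_rot u v w). Qed.

Lemma bary_sum u v w x : orient u v w != 0 ->
  bary u v w x + bary v w u x + bary w u v x = 1.
Proof.
by move=> D; bary_field D.
Qed.

Lemma bary_lin u v w x (a b : R) : orient u v w != 0 ->
  a * x.1 + b * x.2 = bary u v w x * (a * u.1 + b * u.2) +
   bary v w u x * (a * v.1 + b * v.2) + bary w u v x * (a * w.1 + b * w.2).
Proof.
by move=> D; bary_field D.
Qed.

Lemma bary_comb u v w (a b c : R) : orient u v w != 0 -> a + b + c = 1 ->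
  bary u v w (padd (padd (pscale a u) (pscale b v)) (pscale c w)) = a.
Proof.
move=> D abc; have -> : a = 1 - b - c by lra.
by bary_field D.
Qed.

Lemma triangle_rot u v w : triangle u v w = triangle v w u.
Proof.
have key u' v' w' : triangle u' v' w' `<=` triangle v' w' u'.
  move=> x [a [b [c [a0 b0 c0 abc ->]]]]; exists b, c, a; split=> //; first lra.
  by rewrite /padd /pscale /=; congr pair; ring.
by apply/seteqP; split => //; apply: subset_trans (key _ _ _).
Qed.

Lemma triangleP u v w x : orient u v w != 0 -> triangle u v w x <->
  [/\ 0 <= bary u v w x, 0 <= bary v w u x & 0 <= bary w u v x].
Proof.
move=> D; have D1 := orient_rot_neq0 D; have D2 := orient_rot_neq0 D1; split.
  move=> [a [b [c [a0 b0 c0 abc ->]]]]; rewrite bary_comb//; split=> //.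
    rewrite (_ : padd _ _ = padd (padd (pscale b v) (pscale c w)) (pscale a u)).
      by rewrite bary_comb//; lra.
    by rewrite /padd /pscale /=; congr pair; ring.
  rewrite (_ : padd _ _ = padd (padd (pscale c w) (pscale a u)) (pscale b v)).
    by rewrite bary_comb//; lra.
  by rewrite /padd /pscale /=; congr pair; ring.
move=> [a0 b0 c0]; exists (bary u v w x), (bary v w u x), (bary w u v x).
split=> //; first exact: bary_sum.
have := bary_lin x 1 0 D; have := bary_lin x 0 1 D.
rewrite !(mul1r, mul0r, addr0, add0r) => E2 E1.
by rewrite [x]surjective_pairing /padd /pscale /= -E1 -E2.
Qed.

Lemma nbhs_halfplane (a b c : R) f : 0 < a * f.1 + b * f.2 + c ->
  nbhs f [set x | 0 < a * x.1 + b * x.2 + c].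
Proof.
move=> f0.
have cM k (g : R * R -> R) : {for f, continuous g} -> {for f, continuous (fun x => k * g x)}.
  by move=> cg; apply: cvgM; [exact: cvg_cst|exact: cg].
have c1 : {for f, continuous (fst : R * R -> R)} by apply: cvg_fst.
have c2 : {for f, continuous (snd : R * R -> R)} by exact: cvg_snd.
have cont : {for f, continuous (fun x : R * R => a * x.1 + b * x.2 + c : R)}.
  apply: (@cvgD _ _ _ _ _ (fun x : R * R => a * x.1 + b * x.2) (fun=> c)); last exact: cvg_cst.
  by apply: (@cvgD _ _ _ _ _ (fun x : R * R => a * x.1) (fun x => b * x.2)); exact: cM.
exact: (cont _ (lt_nbhsr f0)).
Qed.

Lemma interior_shift (B : set (R * R)) f d : interior B f ->
  exists2 e : R, 0 < e & B (padd f (pscale e d)).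
Proof.
move=> Bf.
have [e e0 He] : exists2 e : R, 0 < e & ball f e `<=` B by apply/nbhs_ballP.
pose M := `|d.1| + `|d.2| + 1.
have [n1 n2] : 0 <= `|d.1| /\ 0 <= `|d.2| by [].
have M0 : 0 < M by rewrite /M; lra.
have eM : 0 < e / M by rewrite divr_gt0.
exists (e / M) => //; apply: He; split; rewrite /ball /= opprD addNKr normrN normrM gtr0_norm//;
  by rewrite mulrAC ltr_pdivrMr// ltr_pM2l// /M; lra.
Qed.

Lemma bary_affine u v w x : orient u v w != 0 ->
  bary u v w x = (v.2 - w.2) / orient u v w * x.1 + (w.1 - v.1) / orient u v w * x.2
    + (v.1 * w.2 - v.2 * w.1) / orient u v w.
Proof.
by move=> D; bary_field D.
Qed.

Lemma interior_triangleP u v w x : orient u v w != 0 ->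
  interior (triangle u v w) x <->
  [/\ 0 < bary u v w x, 0 < bary v w u x & 0 < bary w u v x].
Proof.
move=> D; have D1 := orient_rot_neq0 D; have D2 := orient_rot_neq0 D1; split.
  have key u' v' w' : orient u' v' w' != 0 -> interior (triangle u' v' w') x ->
    0 < bary u' v' w' x.
    move=> D' Ix; have /(triangleP _ D')[x0 _ _] := interior_subset Ix.
    (* Moving [x] away from [u'] turns its coordinate [l] into [(1 + e) * l - e]; this is still
       nonnegative, which forces [l > 0]. *)
    have [e e0] := interior_shift (psub x u') Ix.
    have -> : padd x (pscale e (psub x u')) = padd (pscale (1 + e) x) (pscale (- e) u').
      by rewrite /padd /pscale /psub /=; congr pair; ring.
    move=> /(triangleP _ D')[+ _ _].
    have -> : bary u' v' w' (padd (pscale (1 + e) x) (pscale (- e) u')) =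
              (1 + e) * bary u' v' w' x - e by bary_field D'.
    nra.
  move=> Ix; split; first exact: key.
    by apply: key => //; rewrite -triangle_rot.
  by apply: key => //; rewrite triangle_rot.
move=> [a0 b0 c0].
have H u' v' w' : orient u' v' w' != 0 -> 0 < bary u' v' w' x ->
    nbhs x [set y | 0 < bary u' v' w' y].
  move=> D' ; rewrite bary_affine// => /nbhs_halfplane.
  by apply: filterS => y /=; rewrite bary_affine.
apply: filterS (filterI (H _ _ _ D a0) (filterI (H _ _ _ D1 b0) (H _ _ _ D2 c0))).
by move=> y [/= ? [? ?]]; apply/(triangleP _ D); split; exact: ltW.
Qed.

(** The passage to two barycentric coordinates is affine with determinant [(orient u v w)^-1]. *)
Lemma area_bary u v w (A : set (T1 * T1)) : orient u v w != 0 -> measurable A ->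
  area [set x | A (bary u v w x, bary v w u x)] = (`|orient u v w|%:E * area A)%E.
Proof.
move=> D mA; have D1 := orient_rot_neq0 D.
have E : (v.2 - w.2) / orient u v w * ((u.1 - w.1) / orient v w u) -
   (w.1 - v.1) / orient u v w * ((w.2 - u.2) / orient v w u) = (orient u v w)^-1.
  by rewrite (orient_rot u v w) /orient /=; field; orient_neq0 D.
have D' := invr_neq0 D; rewrite -E in D'.
have := area_affine ((v.1 * w.2 - v.2 * w.1) / orient u v w)
    ((w.1 * u.2 - w.2 * u.1) / orient v w u) D' mA.
rewrite E normfV invrK => <-; congr area; apply: eq_set => x.
by rewrite !bary_affine.
Qed.

(** The two inclusions leave the boundary of the corner free, so any mixture of strict and large
    inequalities is covered. *)
Lemma area_corner u v w (t : R) (A : set (R * R)) : orient u v w != 0 -> t < 1 ->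
  [set x | [/\ t < bary u v w x, 0 < bary v w u x & 0 < bary w u v x]] `<=` A ->
  A `<=` [set x | [/\ t <= bary u v w x, 0 <= bary v w u x & 0 <= bary w u v x]] ->
  area A = (`|orient u v w| * (1 - t) ^+ 2 * simplex_area)%:E.
Proof.
move=> D t1 lA uA.
have W x : bary w u v x = 1 - bary u v w x - bary v w u x.
  by have := bary_sum x D; lra.
have mo : measurable ([set x | [/\ t < x.1, 0 < x.2 & x.1 + x.2 < 1]] : set (T1 * T1)).
  have -> : [set x | [/\ t < x.1, 0 < x.2 & x.1 + x.2 < 1]] =
    [set x : R * R | 0 < 1 * x.1 + 0 * x.2 + - t] `&`
   [set x | 0 < 0 * x.1 + 1 * x.2 + 0] `&` [set x | 0 < -1 * x.1 + -1 * x.2 + 1].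
    by apply/seteqP; split => x /=; [move=> [? ? ?]|move=> [[? ?] ?]]; do ?split; lra.
  by apply: measurableI; [apply: measurableI|]; exact: measurable_halfplane.
have mc : measurable ([set x | [/\ t <= x.1, 0 <= x.2 & x.1 + x.2 <= 1]] : set (T1 * T1)).
  have -> : [set x | [/\ t <= x.1, 0 <= x.2 & x.1 + x.2 <= 1]] =
   ~` [set x : R * R | 0 < -1 * x.1 + 0 * x.2 + t] `&`
   ~` [set x | 0 < 0 * x.1 + -1 * x.2 + 0] `&` ~` [set x | 0 < 1 * x.1 + 1 * x.2 + -1].
    apply/seteqP; split => x /=.
      by move=> [? ? ?]; split; [split|]; apply/negP; rewrite -leNgt; lra.
    by move=> [[/negP + /negP +] /negP]; rewrite -!leNgt => *; split; lra.
  by apply: measurableI; [apply: measurableI|]; apply: measurableC; exact: measurable_halfplane.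
rewrite -mulrA EFinM; apply/eqP; rewrite eq_le; apply/andP; split.
  rewrite -(@area_corner_sandwich _ t _ t1 _ (@subset_refl _ _)); last first.
    by move=> x /= [? ? ?]; split; lra.
  rewrite -area_bary//; apply: le_area; apply: (subset_trans uA) => x /= [? ?].
  by rewrite W; split; lra.
rewrite -(@area_corner_sandwich _ t _ t1 (@subset_refl _ _)); last first.
  by move=> x /= [? ? ?]; split; lra.
rewrite -area_bary//; apply: le_area; apply: subset_trans lA => x /= [? ? ?].
by rewrite W; split; lra.
Qed.

End Barycentric.

(** * Split cuts and a criterion for the strength *)

Section Strength.
Context {R : realType}.
Implicit Types (u v w x f r : R * R) (s : 'I_3 -> R).

Definition lin (a1 a2 : int) x : R := a1%:~R * x.1 + a2%:~R * x.2.

Lemma lin_bary a1 a2 u v w x : orient u v w != 0 ->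
  lin a1 a2 x = bary u v w x * lin a1 a2 u + bary v w u x * lin a1 a2 v +
                bary w u v x * lin a1 a2 w.
Proof. exact: bary_lin. Qed.

Lemma split_setE (a1 a2 b : int) x :
  split_set a1 a2 b x = (b%:~R <= lin a1 a2 x <= b%:~R + 1) :> Prop.
Proof. by []. Qed.

Lemma interior_splitP (a1 a2 b : int) f : gcdz a1 a2 = 1%N ->
  interior (split_set a1 a2 b) f <-> b%:~R < lin a1 a2 f < b%:~R + 1.
Proof.
move=> g1; split => [If|/andP[f1 f2]]; last first.
  have g0 : 0 < a1%:~R * f.1 + a2%:~R * f.2 + - b%:~R :> R by rewrite /lin in f1; lra.
  have h0 : 0 < - a1%:~R * f.1 + - a2%:~R * f.2 + (b%:~R + 1) :> R by rewrite /lin in f2; lra.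
  apply: filterS (filterI (nbhs_halfplane g0) (nbhs_halfplane h0)) => x /= [? ?].
  by apply/andP; split; lra.
(* Coprimality excludes the zero functional, so small moves along [(a1, a2)] and its opposite change
   [lin] strictly. *)
have n0 : (0 : R) < a1%:~R * a1%:~R + a2%:~R * a2%:~R.
  have : (a1%:~R : R) ^+ 2 + a2%:~R ^+ 2 != 0.
    rewrite paddr_eq0 ?sqr_ge0// !sqrf_eq0 !intr_eq0; apply/negP => /andP[/eqP a10 /eqP a20].
    by move: g1; rewrite a10 a20.
  by rewrite !expr2 lt_neqAle eq_sym => ->; rewrite addr_ge0// -expr2 sqr_ge0.
have [e e0] := interior_shift (a1%:~R, a2%:~R) If.
have [d d0] := interior_shift (- a1%:~R, - a2%:~R) If.
rewrite /split_set /padd /pscale /lin /= => /andP[? ?] /andP[? ?].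
have : 0 < e * (a1%:~R * a1%:~R + a2%:~R * a2%:~R) by rewrite mulr_gt0.
have : 0 < d * (a1%:~R * a1%:~R + a2%:~R * a2%:~R) by rewrite mulr_gt0.
by move=> ? ?; apply/andP; split; nra.
Qed.

Lemma minkowski_le (B : set (R * R)) f r (c : R) x : 0 < c -> B x -> r = pscale c (psub x f) ->
  Defs.minkowski B f r <= c.
Proof.
move=> c0 Bx rE; apply: ge_inf; last by split => //; exists x.
by exists 0 => y [/ltW].
Qed.

(** The pair [d], [x] shows that the infimum is taken over a non-empty set; over the empty set it
    would take the default value 0. *)
Lemma le_minkowski (B : set (R * R)) f r (c d : R) x : 0 < d -> B x -> r = pscale d (psub x f) ->
  (forall e y, 0 < e -> B y -> r = pscale e (psub y f) -> c <= e) -> c <= Defs.minkowski B f r.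
Proof.
move=> d0 Bx rE H; apply: lb_le_inf; first by exists d; split => //; exists x.
by move=> e [e0 [y [By rE']]]; exact: (H e y).
Qed.

Lemma minkowski_split_le (a1 a2 b : int) f v (c : R) :
  b%:~R < lin a1 a2 f < b%:~R + 1 -> 0 < c ->
  lin a1 a2 v - lin a1 a2 f <= c * (b%:~R + 1 - lin a1 a2 f) ->
  lin a1 a2 f - lin a1 a2 v <= c * (lin a1 a2 f - b%:~R) ->
  Defs.minkowski (split_set a1 a2 b) f (psub v f) <= c.
Proof.
move=> /andP[f1 f2] c0 h1 h2.
apply: (@minkowski_le _ _ _ _ (padd f (pscale c^-1 (psub v f)))) => //.
  have E : lin a1 a2 (padd f (pscale c^-1 (psub v f))) =
      lin a1 a2 f + (lin a1 a2 v - lin a1 a2 f) / c.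
    by rewrite /lin /padd /pscale /psub /=; field; lra.
  rewrite split_setE E.
  have H1 : (lin a1 a2 v - lin a1 a2 f) / c <= b%:~R + 1 - lin a1 a2 f by rewrite ler_pdivrMr// mulrC.
  have H2 : b%:~R - lin a1 a2 f <= (lin a1 a2 v - lin a1 a2 f) / c by rewrite ler_pdivlMr//; lra.
  by apply/andP; split; lra.
by rewrite /pscale /psub /padd /=; congr pair; field; lra.
Qed.

(** Every admissible factor satisfies these large inequalities, hence so does the infimum. *)
Lemma minkowski_split_ge (a1 a2 b : int) f v :
  b%:~R < lin a1 a2 f < b%:~R + 1 ->
  let c := Defs.minkowski (split_set a1 a2 b) f (psub v f) in
  [/\ 0 <= c,
  lin a1 a2 v - lin a1 a2 f <= c * (b%:~R + 1 - lin a1 a2 f) &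
  lin a1 a2 f - lin a1 a2 v <= c * (lin a1 a2 f - b%:~R)].
Proof.
move=> /andP[f1 f2] c.
have p1 : 0 < b%:~R + 1 - lin a1 a2 f by lra.
have p2 : 0 < lin a1 a2 f - b%:~R by lra.
pose u := lin a1 a2 v - lin a1 a2 f.
(* An admissible factor: it exceeds both quotients needed to stay inside the split, and the summand
   1 keeps it positive when [u = 0]. *)
pose d := `|u| / (b%:~R + 1 - lin a1 a2 f) + `|u| / (lin a1 a2 f - b%:~R) + 1.
have [nu1 nu2] : u <= `|u| /\ - u <= `|u| by rewrite ler_norm -normrN ler_norm.
have n1 : 0 <= `|u| / (b%:~R + 1 - lin a1 a2 f) by rewrite divr_ge0// ltW.
have n2 : 0 <= `|u| / (lin a1 a2 f - b%:~R) by rewrite divr_ge0// ltW.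
have d0 : 0 < d by rewrite /d; lra.
have dE : psub v f = pscale d (psub (padd f (pscale d^-1 (psub v f))) f).
  by rewrite /pscale /psub /padd /=; congr pair; field; lra.
have Bd : split_set a1 a2 b (padd f (pscale d^-1 (psub v f))).
  have E : lin a1 a2 (padd f (pscale d^-1 (psub v f))) = lin a1 a2 f + u / d.
    by rewrite /u /lin /padd /pscale /psub /=; field; lra.
  rewrite split_setE E.
  have H1 : u / d <= b%:~R + 1 - lin a1 a2 f.
    rewrite ler_pdivrMr// mulrC -ler_pdivrMr//; apply: (@le_trans _ _ (`|u| / (b%:~R + 1 - lin a1 a2 f))).
      by rewrite ler_pM2r ?invr_gt0.
    by rewrite /d; lra.
  have H2 : - u / d <= lin a1 a2 f - b%:~R.
    rewrite ler_pdivrMr// mulrC -ler_pdivrMr//; apply: (@le_trans _ _ (`|u| / (lin a1 a2 f - b%:~R))).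
      by rewrite ler_pM2r ?invr_gt0.
    by rewrite /d; lra.
  by apply/andP; split; rewrite mulNr in H2; lra.
have key e y : 0 < e -> split_set a1 a2 b y -> psub v f = pscale e (psub y f) ->
   u <= e * (b%:~R + 1 - lin a1 a2 f) /\ - u <= e * (lin a1 a2 f - b%:~R).
  move=> e0 /andP[]; rewrite -/(lin a1 a2 y) => y1 y2 [E1 E2].
  have -> : u = e * (lin a1 a2 y - lin a1 a2 f).
    transitivity (a1%:~R * (v.1 - f.1) + a2%:~R * (v.2 - f.2)); first by rewrite /u /lin; ring.
    by rewrite E1 E2 /lin; ring.
  by rewrite -mulrN !ler_pM2l//; split; lra.
split.
- by apply: (le_minkowski d0 Bd dE) => e y /ltW.
- rewrite -ler_pdivrMr//; apply: (le_minkowski d0 Bd dE) => e y e0 By rE.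
  by rewrite ler_pdivrMr//; case: (key e y e0 By rE).
- rewrite -ler_pdivrMr//; apply: (le_minkowski d0 Bd dE) => e y e0 By rE.
  by rewrite ler_pdivrMr//; case: (key e y e0 By rE) => _; rewrite /u opprB.
Qed.

(** The vertex itself gives the factor 1. A factor [e < 1] would need a point beyond [u], whose
    coordinate at [v] is [(e - 1) / e] times that of [f], hence negative. *)
Lemma minkowski_corner u v w f : orient u v w != 0 -> 0 < bary v w u f ->
  Defs.minkowski (triangle u v w) f (psub u f) = 1.
Proof.
move=> D f0.
have uT : triangle u v w u.
  by exists 1, 0, 0; split=> //; rewrite ?addr0// [LHS]surjective_pairing /padd /pscale /=;
    congr pair; ring.
have uE : psub u f = pscale 1 (psub u f) by rewrite /pscale !mul1r -surjective_pairing.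
apply/eqP; rewrite eq_le (minkowski_le ltr01 uT uE)/=.
apply: (le_minkowski ltr01 uT uE) => e y e0 /(triangleP _ D) [_ y0 _] [E1 E2].
have D1 := orient_rot_neq0 D.
have : e * bary v w u y = (e - 1) * bary v w u f.
  have E1' : e * y.1 = u.1 - f.1 + e * f.1 by rewrite E1; ring.
  have E2' : e * y.2 = u.2 - f.2 + e * f.2 by rewrite E2; ring.
  have -> : e * bary v w u y = ((w.2 - u.2) / orient v w u * (e * y.1) + (u.1 - w.1) / orient v w u * (e * y.2)
    + e * (w.1 * u.2 - w.2 * u.1) / orient v w u) by rewrite bary_affine//; ring.
  by rewrite E1' E2' bary_affine//; ring.
have : 0 <= e * bary v w u y by rewrite mulr_ge0// ltW.
by move=> + E; rewrite E pmulr_lge0//; lra.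
Qed.

(** Spelled with [lift] to match the indices produced by [big_ord_recl]. *)
Definition i0 : 'I_3 := ord0.
Definition i1 : 'I_3 := lift ord0 ord0.
Definition i2 : 'I_3 := lift ord0 (lift ord0 ord0).

Lemma sum3 (F : 'I_3 -> R) : \sum_(j < 3) F j = F i0 + F i1 + F i2.
Proof. by rewrite !big_ord_recl big_ord0 addr0 addrA. Qed.

Lemma cut_holdsE B u v w f s : cut_holds B f (corner_rays u v w f) s <->
  1 <= Defs.minkowski B f (psub u f) * s i0 + Defs.minkowski B f (psub v f) * s i1 +
       Defs.minkowski B f (psub w f) * s i2.
Proof. by rewrite /cut_holds sum3. Qed.

(* [c] bounds the coefficient of a ray from [f] to [v] in the cut of a split,
   where [th] and [l] are the positions of [f] and [v] relative to the split. *)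
Definition split_coef_le th l (c : R) :=
  [/\ 0 < c, l - th <= c * (1 - th) & th - l <= c * th].

(** As [s] is nonnegative, the Minkowski functionals in the cut may be replaced by upper bounds. All
    upper bounds on the strength go through this lemma. *)
Lemma split_cut (a1 a2 b : int) u v w f s (c0 c1 c2 : R) :
  let th := lin a1 a2 f - b%:~R in
  gcdz a1 a2 = 1%N -> 0 < th < 1 -> split_closure f (corner_rays u v w f) s ->
  split_coef_le th (lin a1 a2 u - b%:~R) c0 ->
  split_coef_le th (lin a1 a2 v - b%:~R) c1 ->
  split_coef_le th (lin a1 a2 w - b%:~R) c2 ->
  1 <= c0 * s i0 + c1 * s i1 + c2 * s i2.
Proof.
move=> th g1 /andP[th0 th1] [s0 sS].
have fb : b%:~R < lin a1 a2 f < b%:~R + 1 by apply/andP; rewrite /th in th0 th1; split; lra.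
have : splits_at f (split_set a1 a2 b).
  by split; [exists a1, a2, b|apply/interior_splitP].
move=> /sS/cut_holdsE + [u0 u1 u2] [v0 v1 v2] [w0 w1 w2] => /le_trans; apply.
have le_coef x c : 0 < c -> lin a1 a2 x - b%:~R - th <= c * (1 - th) ->
    th - (lin a1 a2 x - b%:~R) <= c * th -> Defs.minkowski (split_set a1 a2 b) f (psub x f) <= c.
  rewrite /th => c0' h1 h2; apply: minkowski_split_le => //; lra.
by apply: lerD; [apply: lerD|]; apply: ler_wpM2r => //; exact: le_coef.
Qed.

(** The Minkowski functionals are abstracted to arbitrary nonnegative [c0], [c1], [c2] subject to
    linear inequalities, which reduces membership in the split closure to arithmetic. *)
Lemma split_closure_intro u v w f s : nonneg3 s ->
  (forall a1 a2 b : int, b%:~R < lin a1 a2 f < b%:~R + 1 -> forall c0 c1 c2 : R,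
   0 <= c0 -> 0 <= c1 -> 0 <= c2 ->
   lin a1 a2 u - lin a1 a2 f <= c0 * (b%:~R + 1 - lin a1 a2 f) ->
   lin a1 a2 f - lin a1 a2 u <= c0 * (lin a1 a2 f - b%:~R) ->
   lin a1 a2 v - lin a1 a2 f <= c1 * (b%:~R + 1 - lin a1 a2 f) ->
   lin a1 a2 f - lin a1 a2 v <= c1 * (lin a1 a2 f - b%:~R) ->
   lin a1 a2 w - lin a1 a2 f <= c2 * (b%:~R + 1 - lin a1 a2 f) ->
   lin a1 a2 f - lin a1 a2 w <= c2 * (lin a1 a2 f - b%:~R) ->
   1 <= c0 * s i0 + c1 * s i1 + c2 * s i2) ->
  split_closure f (corner_rays u v w f) s.
Proof.
move=> s0 H; split => // _ [[a1 [a2 [b [g1 ->]]]] /(interior_splitP _ _ g1) fb].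
apply/cut_holdsE.
have [? ? ?] := minkowski_split_ge u fb.
have [? ? ?] := minkowski_split_ge v fb.
have [? ? ?] := minkowski_split_ge w fb.
exact: (H a1 a2 b fb).
Qed.

Lemma cut_holds_triangle u v w f s : orient u v w != 0 -> interior (triangle u v w) f ->
  cut_holds (triangle u v w) f (corner_rays u v w f) s <-> 1 <= s i0 + s i1 + s i2.
Proof.
move=> D /(interior_triangleP _ D)[f1 f2 f3].
have D1 := orient_rot_neq0 D; have D2 := orient_rot_neq0 D1.
rewrite cut_holdsE minkowski_corner// mul1r.
by rewrite triangle_rot minkowski_corner// mul1r triangle_rot minkowski_corner// mul1r.
Qed.

Definition strength_at u v w f : \bar R :=
  strength (split_plus_closure (triangle u v w) f (corner_rays u v w f))
           (split_closure f (corner_rays u v w f)).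

Lemma strength_leP u v w f (z : R) : orient u v w != 0 -> interior (triangle u v w) f ->
  1 <= z ->
  (strength_at u v w f <= z%:E)%E <->
  (forall s, split_closure f (corner_rays u v w f) s -> 1 <= z * (s i0 + s i1 + s i2)).
Proof.
move=> D If z1; split => [+ s Qs|H].
  rewrite leNgt => /negP hz; rewrite leNgt; apply/negP => sz; apply: hz.
  have s0 : 0 <= s i0 + s i1 + s i2 by case: Qs => s0 _; rewrite !addr_ge0.
  pose S := s i0 + s i1 + s i2.
  (* The strength is an infimum, so a bound [zz] strictly above [z] is needed: if [zz * S < 1], no
     admissible factor lies below [zz]. *)
  have [zz zz1 zz2] : exists2 zz, z < zz & zz * S < 1.
    exists (z + (1 - z * S) / (1 + S)).
      by rewrite ltrDl divr_gt0 ?subr_gt0// /S; lra.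
    have : (1 - z * S) / (1 + S) * S < 1 - z * S.
      rewrite mulrAC ltr_pdivrMr ?ltr_pM2l ?subr_gt0// /S; lra.
    by rewrite mulrDl; lra.
  apply: (@lt_le_trans _ _ zz%:E); first by rewrite lte_fin.
  apply: le_ereal_inf_tmp => -[r| |] /= [a1 Qa]; rewrite ?leey//.
  have := Qa _ Qs; rewrite /= => -[_ /(_ (triangle u v w)) /(_ (or_intror erefl))].
  move=> /(cut_holds_triangle _ D If); rewrite -!mulrDr -/S => rS.
  rewrite lee_fin leNgt; apply/negP => rzz.
  have : r * S <= zz * S by rewrite ler_wpM2r// ltW.
  lra.
apply: ereal_inf_lbound; split; first by rewrite lee_fin.
move=> s Qs; have [s0 sS] := Qs.
have zs0 : nonneg3 (fun j => z * s j) by move=> j; rewrite mulr_ge0//; lra.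
split => // B [/sS|->]; last first.
  by apply/(cut_holds_triangle _ D If); rewrite -!mulrDr; exact: H.
(* Split cuts survive the scaling because [s] satisfies them and [z >= 1]. *)
rewrite /cut_holds => h1.
under eq_bigr do rewrite mulrCA.
rewrite -mulr_sumr; nra.
Qed.

End Strength.

(** * Integer inequalities behind the split cuts of type 1 triangles *)

Section SplitArithmetic.
Context {R : realType}.
Implicit Types (l k c th : R) (m : int).

(** Here [c - 1] is the excess over 1 of the coefficient of a vertex at position [2 * m] relative to
    the split. The first and last bounds use integrality: either [m >= 1], so that [2 * m - 1 >= m],
    or [m <= 0]. *)
Lemma split_coef_excess th c m : 0 < th < 1 ->
  (2 * m)%:~R - th <= c * (1 - th) -> th - (2 * m)%:~R <= c * th ->
  [/\ 0 <= c - 1, 2 * m%:~R - 1 <= (1 - th) * (c - 1), - 2 * m%:~R <= th * (c - 1) &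
      m%:~R <= (1 - th) * (c - 1)].
Proof.
move=> /andP[th0 th1]; rewrite intrM => h1 h2.
have [m1|m0] := lerP 1 m.
  have : (1 : R) <= m%:~R by rewrite ler1z.
  by move=> M; split; nra.
have M : m%:~R <= (0 : R) by rewrite lerz0 -ltzD1 add0r.
by split; nra.
Qed.

(** The weights [1 - 2 * l_j] are nonnegative, and the [m_j] weighted by them sum to [M - th] with
    [M = m1 + m2 + m3]. If [M >= 1] the bounds involving [1 - th] suffice, and if [M <= 0] those
    involving [th]. *)
Lemma medial_excess l1 l2 l3 k1 k2 k3 th m1 m2 m3 :
  l1 + l2 + l3 = 1 -> l1 <= 2^-1 -> l2 <= 2^-1 -> l3 <= 2^-1 -> 0 < th < 1 ->
  2 * (l1 * m1%:~R + l2 * m2%:~R + l3 * m3%:~R) = th ->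
  m1%:~R <= (1 - th) * k1 -> - 2 * m1%:~R <= th * k1 ->
  m2%:~R <= (1 - th) * k2 -> - 2 * m2%:~R <= th * k2 ->
  m3%:~R <= (1 - th) * k3 -> - 2 * m3%:~R <= th * k3 ->
  1 <= (1 - 2 * l1) * k1 + (1 - 2 * l2) * k2 + (1 - 2 * l3) * k3.
Proof.
move=> ls h1 h2 h3 /andP[th0 th1] thE a1 b1 a2 b2 a3 b3.
have [|] := lerP 1 (m1 + m2 + m3).
  rewrite -(ler1z R) !intrD => M.
  by rewrite -(ler_pM2l (x := 1 - th)); nra.
rewrite -{1}[1]add0r ltzD1 -(lerz0 R) !intrD => M.
by rewrite -(ler_pM2l (x := th)); nra.
Qed.

(** The weights of [k2] and [k3] are nonnegative because [l1 >= 1/2]. Each excess has lower bounds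
    from both sides of the split, and the signs of a few integer combinations of the [m_j] decide
    which bounds to combine. Ordering [m3 <= m2] halves the cases. *)
Lemma corner_excess l1 l2 l3 k2 k3 th m1 m2 m3 :
  l1 + l2 + l3 = 1 -> 2^-1 <= l1 -> 0 < l2 -> 0 < l3 -> 0 < th < 1 ->
  2 * (l1 * m1%:~R + l2 * m2%:~R + l3 * m3%:~R) = th ->
  0 <= k2 -> 2 * m2%:~R - 1 <= (1 - th) * k2 -> - 2 * m2%:~R <= th * k2 ->
  m2%:~R <= (1 - th) * k2 ->
  0 <= k3 -> 2 * m3%:~R - 1 <= (1 - th) * k3 -> - 2 * m3%:~R <= th * k3 ->
  m3%:~R <= (1 - th) * k3 ->
  1 <= (1 - 2 * l2) * k2 + (1 - 2 * l3) * k3.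
Proof.
wlog m32 : l2 l3 k2 k3 m2 m3 / (m3 <= m2)%R.
  move=> hw; have [|/ltW] := lerP m3 m2; first exact: hw.
  move=> m23 ls h1 h2 h3 th01 thE k20 a2 b2 d2 k30 a3 b3 d3.
  by rewrite addrC; apply: (hw l3 l2 k3 k2 m3 m2) => //; lra.
move=> ls h1 h2 h3 /andP[th0 th1] thE k20 a2 b2 d2 k30 a3 b3 d3.
have l12 : 0 <= l1 - l2 by lra.
have l13 : 0 <= l1 - l3 by lra.
have l10 : 0 <= l1 by lra.
have {}h2 := ltW h2; have {}h3 := ltW h3.
(* Integrality enters only here, through the gap between 0 and 1 for the listed combinations; the
   [m_j] are then generalized to reals. *)
have dich m : 1 <= (m%:~R : R) \/ (m%:~R : R) <= 0.
  by have [|] := lerP 1 m; [rewrite -(ler1z R); left|rewrite -[1]add0r ltzD1 -(lerz0 R); right].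
move: m32 (dich (m2 + m3)) (dich m1) (dich m2) (dich m3)
  (dich (m1 + m2)) (dich (m1 + m3)) (dich (m1 + m2 + m3)) (dich (m1 + m2 + m3 - 1)).
rewrite -(ler_int R) !intrD mulrN1z {dich}.
move: (m1%:~R : R) (m2%:~R : R) (m3%:~R : R) thE a2 b2 d2 a3 b3 d3
  => x1 x2 x3 thE a2 b2 d2 a3 b3 d3 x32.
have E2 : (l1 + l2 + l3) * x2 = x2 by rewrite ls mul1r.
have E3 : (l1 + l2 + l3) * x3 = x3 by rewrite ls mul1r.
set p := 1 - 2 * l2; set q := 1 - 2 * l3.
have p0 : 0 <= p by rewrite /p; lra.
have q0 : 0 <= q by rewrite /q; lra.
have e0 : 0 < 1 - th by lra.
(* [goalP] multiplies the claim by [1 - th], and [goalN] below multiplies it by [th]. *)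
have goalP y2 y3 : y2 <= (1 - th) * k2 -> y3 <= (1 - th) * k3 ->
    1 - th <= p * y2 + q * y3 -> 1 <= p * k2 + q * k3.
  move=> le2 le3 H; rewrite -(ler_pM2l e0) mulr1 (le_trans H)// mulrDr !(mulrCA (1 - th)).
  by apply: lerD; exact: ler_wpM2l.
have goalN y2 y3 : y2 <= th * k2 -> y3 <= th * k3 ->
    th <= p * y2 + q * y3 -> 1 <= p * k2 + q * k3.
  move=> le2 le3 H; rewrite -(ler_pM2l th0) mulr1 (le_trans H)// mulrDr !(mulrCA th).
  by apply: lerD; exact: ler_wpM2l.
have ek3 : 0 <= (1 - th) * k3 by rewrite mulr_ge0// ltW.
have tk2 : 0 <= th * k2 by rewrite mulr_ge0// ltW.
(* The names record the bounds chosen. With the factor [1 - th], [PP] takes [m] twice, [P22] takes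
   [2 * m - 1] twice, and [P20] drops [k3]. With the factor [th], [NN] takes [- 2 * m] twice and
   [N0] drops [k2]. *)
have {goalP} [PP P22 P20] := And3 (goalP _ _ d2 d3) (goalP _ _ a2 a3) (goalP _ _ a2 ek3).
have {goalN} [NN N0] := conj (goalN _ _ b2 b3) (goalN _ _ tk2 b3).
rewrite mulr0 addr0 in P20; rewrite mulr0 add0r in N0.
clear p0 q0 e0 ek3 tk2 k20 k30 a2 b2 d2 a3 b3 d3.
have mul_ge0 (a b : R) : 0 <= a -> 0 <= b -> 0 <= a * b by exact: mulr_ge0.
(* Four cases, by the signs of [m2 + m3] and of [m1]. The facts [F1], [F2], [F3] are products of
   nonnegative factors that make each of them linear. *)
case=> [M|M]; case=> [M1|M1] H2 H3 H12 H13 H123 H123'.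
- move=> {H2 H3 H12 H13 H123 H123' P22 P20 NN N0}.
  apply: PP; have F1 := mul_ge0 l1 (x1 - 1) l10 ltac:(lra); rewrite /p /q; lra.
- move=> {H13 H123 PP NN N0}.
  have {H2} M2 : 1 <= x2 by move=> {H3 H12 H123'}; case: H2 => // ?; lra.
  case: H3 => M3.
    move=> {H12}; apply: P22; case: H123' => L.
      have F1 := mul_ge0 l1 (x1 + x2 + x3 - 1 - 1) l10 ltac:(lra).
      have F2 := mul_ge0 l3 x2 h3 ltac:(lra).
      have F3 := mul_ge0 l2 x3 h2 ltac:(lra).
      rewrite /p /q; lra.
    have F1 := mul_ge0 l2 (- x1 - x2) h2 ltac:(lra).
    have F2 := mul_ge0 l3 (- x1 - x3) h3 ltac:(lra).
    have F3 := mul_ge0 (l1 - l2 - l3) (- x1) ltac:(lra) ltac:(lra).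
    lra.
  move=> {H123'}; apply: P20; case: H12 => L.
    have F1 := mul_ge0 l1 (x2 - 1 + x1) l10 ltac:(lra).
    have F2 := mul_ge0 l3 (x2 - 1 + x3) h3 ltac:(lra).
    rewrite /p; lra.
  have F1 := mul_ge0 l2 (- x1 - x2) h2 ltac:(lra).
  have F2 := mul_ge0 (l1 - l2) (- x1) l12 ltac:(lra).
  have F3 := mul_ge0 l3 (- x3) h3 ltac:(lra).
  lra.
- move=> {H3 H12 H123' PP P22 P20}.
  have M3 : x3 <= 0 by move=> {H2 H13 H123}; lra.
  case: H2 => M2.
    move=> {H123}; apply: N0; case: H13 => L.
      have F1 := mul_ge0 l1 (x1 + x3 - 1) l10 ltac:(lra).
      have F2 := mul_ge0 l2 x2 h2 ltac:(lra).
      have F3 := mul_ge0 (l1 - l3) (- x3) l13 ltac:(lra).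
      lra.
    have F1 := mul_ge0 l1 (- x3 - x1) l10 ltac:(lra).
    have F2 := mul_ge0 l2 (- x3 - x2) h2 ltac:(lra).
    rewrite /q; lra.
  move=> {H13}; apply: NN; case: H123 => L.
    have F1 := mul_ge0 l1 (x1 + x2 + x3 - 1) l10 ltac:(lra).
    have F2 := mul_ge0 (l1 - l2) (- x2) l12 ltac:(lra).
    have F3 := mul_ge0 (l1 - l3) (- x3) l13 ltac:(lra).
    lra.
  have F1 := mul_ge0 l1 (- x1 - x2 - x3) l10 ltac:(lra).
  have F2 := mul_ge0 l3 (- x2) h3 ltac:(lra).
  have F3 := mul_ge0 l2 (- x3) h2 ltac:(lra).
  rewrite /p /q; lra.
- move=> {H2 H3 H12 H13 H123 H123' PP P22 P20 N0}.
  apply: NN; have F1 := mul_ge0 l1 (- x1) l10 ltac:(lra); rewrite /p /q; lra.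
Qed.

End SplitArithmetic.

(** * Strength over triangles of type 1 *)

Lemma int_parity (n : int) : exists k : int, n = 2 * k \/ n = 2 * k + 1.
Proof.
exists (n %/ 2)%Z; rewrite [n in n = _](divz_eq n 2) [n in _ \/ n = _](divz_eq n 2).
have : (0 <= n %% 2)%Z by rewrite modz_ge0.
have : (n %% 2 < 2)%Z by rewrite ltz_pmod.
move: (n %% 2)%Z => -[[|[|m]]|m] //= _ _; rewrite (mulrC (n %/ 2)%Z); [left|right] => //.
by rewrite addr0.
Qed.

Section Type1.
Context {R : realType}.
Implicit Types (u v w x p f : R * R) (s : 'I_3 -> R).

(** Reflection in the midpoint preserves the lattice and the open segment, so it fixes the unique
    lattice point. *)
Lemma one_lattice_midpoint u v : is_lattice u -> is_lattice v ->
  one_lattice_pt_in_relint u v -> is_lattice (pscale 2^-1 (padd u v)).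
Proof.
move=> [[u1 u1E] [u2 u2E]] [[v1 v1E] [v2 v2E]] [p [[lp [t [/andP[t0 t1] pE]]] up]].
have lq : is_lattice (psub (padd u v) p).
  have [[p1 p1E] [p2 p2E]] := lp.
  by split; rewrite /= ?u1E ?u2E ?v1E ?v2E ?p1E ?p2E;
   [exists (u1 + v1 - p1)|exists (u2 + v2 - p2)]; rewrite intrB intrD.
suff <- : p = pscale 2^-1 (padd u v) by [].
have /up pq : is_lattice (psub (padd u v) p) /\ open_segment u v (psub (padd u v) p).
  split => //; exists (1 - t); split; first by apply/andP; split; lra.
  by rewrite pE /psub /padd /pscale /=; congr pair; ring.
have [E1 E2] : p.1 = u.1 + v.1 - p.1 /\ p.2 = u.2 + v.2 - p.2.
  by rewrite {1 3}pq.
by rewrite [LHS]surjective_pairing /pscale /padd /=; congr pair; lra.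
Qed.

Lemma lin_int a1 a2 x : is_lattice x -> exists k : int, lin a1 a2 x = k%:~R.
Proof.
move=> [[x1 x1E] [x2 x2E]]; exists (a1 * x1 + a2 * x2).
by rewrite /lin x1E x2E intrD !intrM.
Qed.

Lemma lin_even a1 a2 u v : is_lattice u -> is_lattice v ->
  one_lattice_pt_in_relint u v ->
  exists k : int, lin a1 a2 v = lin a1 a2 u + 2 * k%:~R.
Proof.
move=> lu lv /(one_lattice_midpoint lu lv) lm.
have [k kE] := lin_int a1 a2 lm; have [l lE] := lin_int a1 a2 lu.
exists (k - l); rewrite intrB -kE -lE /lin /pscale /padd /=; lra.
Qed.

(** Type 1 bundled with lattice-freeness, in a form stable under rotation of the vertices. *)
Definition type1_at u v w :=
  [/\ orient u v w != 0, is_lattice u, is_lattice v, is_lattice w &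
  [/\ one_lattice_pt_in_relint u v, one_lattice_pt_in_relint v w,
      one_lattice_pt_in_relint w u &
   forall x, is_lattice x -> ~ interior (triangle u v w) x]].

Lemma type1_at_rot u v w : type1_at u v w -> type1_at v w u.
Proof.
move=> [D lu lv lw [uv vw wu H]]; split=> //; first exact: orient_rot_neq0.
by split=> //; rewrite -triangle_rot.
Qed.

Lemma bary_vertex u v w : orient u v w != 0 ->
  [/\ bary u v w u = 1, bary u v w v = 0 & bary u v w w = 0].
Proof.
by move=> D; rewrite /bary divff//; split => //; rewrite /orient !subrr !(mulr0,mul0r) ?subrr ?subr0 ?mul0r// mulrC subrr mul0r.
Qed.

Lemma floor_frac (a : R) : exists k : int, k%:~R <= a < k%:~R + 1.
Proof. by exists (Num.floor a); have := floor_itv a; rewrite intrD. Qed.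

(** The entries of [x - y] are Bezout coefficients for [a1] and [a2]. *)
Lemma gcdz_lin a1 a2 x y : is_lattice x -> is_lattice y ->
  lin a1 a2 x - lin a1 a2 y = 1 -> gcdz a1 a2 = 1%N.
Proof.
move=> [[x1 x1E] [x2 x2E]] [[y1 y1E] [y2 y2E]].
rewrite /lin x1E x2E y1E y2E -!intrM -!intrD -intrB -[RHS]/(1%:~R) => /intr_inj E.
suff /eqP : coprimez a1 a2 by [].
apply/coprimezP; exists (x1 - y1, x2 - y2) => /=.
rewrite -E; ring.
Qed.

(** Half-edges are lattice vectors. Modulo them [x] becomes a lattice point [y] with coordinates in
    [[0, 1/2)] at [v] and [w]. It is not interior, and on the open edge from [u] to [v] it would be
    the midpoint, with coordinate 1/2; so its coordinate at [v] is 0. *)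
Lemma type1_lattice_coord u v w x : type1_at u v w -> is_lattice x ->
  is_int (2 * bary v w u x).
Proof.
move=> T lx; have [D lu lv lw [uv _ wu H]] := T.
have D1 := orient_rot_neq0 D; have D2 := orient_rot_neq0 D1.
have [A /andP[A0 A1]] := floor_frac (2 * bary v w u x).
have [B /andP[B0 B1]] := floor_frac (2 * bary w u v x).
pose y : R * R := (x.1 - A%:~R * ((v.1 - u.1) / 2) - B%:~R * ((w.1 - u.1) / 2),
                   x.2 - A%:~R * ((v.2 - u.2) / 2) - B%:~R * ((w.2 - u.2) / 2)).
have bv : bary v w u y = bary v w u x - A%:~R / 2 by bary_field D1.
have bw : bary w u v y = bary w u v x - B%:~R / 2 by bary_field D2.
have bu : bary u v w y = 1 - bary v w u y - bary w u v y by have := bary_sum y D; lra.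
have ly : is_lattice y.
  have [[x1 x1E] [x2 x2E]] := lx; have [[u1 u1E] [u2 u2E]] := lu.
  have [[k1 +] [k2 +]] := one_lattice_midpoint lu lv uv.
  have [[l1 +] [l2 +]] := one_lattice_midpoint lw lu wu.
  rewrite /pscale /padd /= => l1E l2E k1E k2E.
  split; [exists (x1 - A * (k1 - u1) - B * (l1 - u1))|exists (x2 - A * (k2 - u2) - B * (l2 - u2))];
    by rewrite /y /= !intrB !intrM !intrB -?x1E -?x2E -?k1E -?l1E -?k2E -?l2E -?u1E -?u2E; lra.
have [by0|by0] := ltP 0 (bary v w u y); last by exists A; lra.
have [bw0|bw0] := ltP 0 (bary w u v y).
  by case: (H y ly); apply/(interior_triangleP _ D); split => //; lra.
have [p [_ up]] := uv.
have yuv : open_segment u v y.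
  exists (bary v w u y); split; first by apply/andP; split; lra.
  have := bary_lin y 1 0 D; have := bary_lin y 0 1 D.
  rewrite !(mul1r, mul0r, addr0, add0r) => E2 E1.
  have b0 : bary w u v y = 0 by lra.
  rewrite bu b0 subr0 !mul0r !addr0 in E1 E2.
  by rewrite [LHS]surjective_pairing /padd /pscale /= -E1 -E2.
have muv : open_segment u v (pscale 2^-1 (padd u v)).
  exists 2^-1; split; first by apply/andP; split; lra.
  by rewrite /padd /pscale /=; congr pair; lra.
have ym : y = pscale 2^-1 (padd u v).
  by rewrite -(up _ (conj ly yuv)) -(up _ (conj (one_lattice_midpoint lu lv uv) muv)).
have : bary v w u y = 2^-1 by rewrite ym; bary_field D1.
lra.
Qed.

(** The values of [2 * bary u v w] at three lattice points give integral coefficients. They are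
    coprime because the midpoint of [u] and [v] has value 1 and [w] has value 0. *)
Lemma type1_split u v w : type1_at u v w ->
  exists a1 a2 c : int, gcdz a1 a2 = 1%N /\
    forall x, lin a1 a2 x = 2 * bary u v w x + c%:~R.
Proof.
move=> T; have T2 := type1_at_rot (type1_at_rot T).
have [D lu lv lw [uv _ _ _]] := T.
have l00 : is_lattice ((0, 0) : R * R) by split; exists 0.
have l10 : is_lattice ((1, 0) : R * R) by split; [exists 1|exists 0].
have l01 : is_lattice ((0, 1) : R * R) by split; [exists 0|exists 1].
have [c cE] := type1_lattice_coord T2 l00.
have [a aE] := type1_lattice_coord T2 l10.
have [b bE] := type1_lattice_coord T2 l01.
have linE x : lin (a - c) (b - c) x = 2 * bary u v w x + (- c)%:~R.
  rewrite /lin !intrB mulrNz -cE -aE -bE !(bary_affine _ D) /=; ring.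
exists (a - c), (b - c), (- c); split => //.
apply: (gcdz_lin (one_lattice_midpoint lu lv uv) lw).
rewrite !linE; have [_ _ ->] := bary_vertex D.
have -> : bary u v w (pscale 2^-1 (padd u v)) = 2^-1 by bary_field D.
lra.
Qed.

(** For a coordinate [l < 1/2] of [f], take the split between the values 0 and 1 of twice that
    coordinate. Its vertex is at position 2 and gets the coefficient [1 + (1 - 2 * l)^-1]; the other
    two are at position 0 and get 1. *)
Lemma type1_cuts u v w f s : type1_at u v w -> interior (triangle u v w) f ->
  split_closure f (corner_rays u v w f) s ->
  let S := s i0 + s i1 + s i2 in
  [/\ bary u v w f < 2^-1 -> (1 - S) * (1 - 2 * bary u v w f) <= s i0,
      bary v w u f < 2^-1 -> (1 - S) * (1 - 2 * bary v w u f) <= s i1 &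
      bary w u v f < 2^-1 -> (1 - S) * (1 - 2 * bary w u v f) <= s i2].
Proof.
move=> T; have T1 := type1_at_rot T; have T2 := type1_at_rot T1.
have [D _ _ _ _] := T; have [D1 _ _ _ _] := T1; have [D2 _ _ _ _] := T2.
move=> /(interior_triangleP _ D)[f1 f2 f3] Qs S.
have [uu uv uw] := bary_vertex D.
have [vv vw vu] := bary_vertex D1.
have [ww wu wv] := bary_vertex D2.
have ok2 (t : R) : 0 < t -> t < 2^-1 -> split_coef_le (2 * t) 2 (1 + (1 - 2 * t)^-1).
  move=> t0 t1; have e : (1 - 2 * t)^-1 * (1 - 2 * t) = 1 by rewrite mulVf// gt_eqF//; lra.
  have it : 0 < (1 - 2 * t)^-1 by rewrite invr_gt0; lra.
  by split; nra.
have ok0 (t : R) : 0 < t -> t < 2^-1 -> split_coef_le (2 * t) 0 1 by move=> *; split; lra.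
have th01 (t : R) : 0 < t -> t < 2^-1 -> 0 < 2 * t < 1 by move=> *; apply/andP; split; lra.
have fin (a b : R) : b < 2^-1 -> 1 <= S + (1 - 2 * b)^-1 * a -> (1 - S) * (1 - 2 * b) <= a.
  move=> b2 H; rewrite -ler_pdivlMr; lra.
have sub0 (c : int) : 2 * 0 + c%:~R - c%:~R = 0 :> R by rewrite addrK mulr0.
have sub1 (c : int) : 2 * 1 + c%:~R - c%:~R = 2 :> R by rewrite addrK mulr1.
split=> h.
- have [a1 [a2 [c [g1 E]]]] := type1_split T.
  have := @split_cut R a1 a2 c u v w f s (1 + (1 - 2 * bary u v w f)^-1) 1 1 g1.
  rewrite !E uu uv uw sub0 sub1 addrK => /(_ (th01 _ f1 h) Qs (ok2 _ f1 h) (ok0 _ f1 h) (ok0 _ f1 h)) H.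
  by apply: (fin _ _ h); rewrite /S; lra.
- have [a1 [a2 [c [g1 E]]]] := type1_split T1.
  have := @split_cut R a1 a2 c u v w f s 1 (1 + (1 - 2 * bary v w u f)^-1) 1 g1.
  rewrite !E vv vw vu sub0 sub1 addrK => /(_ (th01 _ f2 h) Qs (ok0 _ f2 h) (ok2 _ f2 h) (ok0 _ f2 h)) H.
  by apply: (fin _ _ h); rewrite /S; lra.
- have [a1 [a2 [c [g1 E]]]] := type1_split T2.
  have := @split_cut R a1 a2 c u v w f s 1 1 (1 + (1 - 2 * bary w u v f)^-1) g1.
  rewrite !E ww wu wv sub0 sub1 addrK => /(_ (th01 _ f3 h) Qs (ok0 _ f3 h) (ok0 _ f3 h) (ok2 _ f3 h)) H.
  by apply: (fin _ _ h); rewrite /S; lra.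
Qed.

(* Membership in the split closure only has to be checked for splits
   [b <= lin a1 a2 <= b + 1] with [lin a1 a2 - b] even at the vertices: on
   lattice triangles of type 1 the three vertices have the same parity, and
   negating the split exchanges the parities. *)
Lemma type1_split_closure u v w f s : type1_at u v w -> interior (triangle u v w) f ->
  nonneg3 s ->
  (forall (th k0 k1 k2 : R) (m0 m1 m2 : int), 0 < th < 1 ->
   2 * (bary u v w f * m0%:~R + bary v w u f * m1%:~R + bary w u v f * m2%:~R) = th ->
   [/\ 0 <= k0, 2 * m0%:~R - 1 <= (1 - th) * k0, - 2 * m0%:~R <= th * k0 & m0%:~R <= (1 - th) * k0] ->
   [/\ 0 <= k1, 2 * m1%:~R - 1 <= (1 - th) * k1, - 2 * m1%:~R <= th * k1 & m1%:~R <= (1 - th) * k1] ->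
   [/\ 0 <= k2, 2 * m2%:~R - 1 <= (1 - th) * k2, - 2 * m2%:~R <= th * k2 & m2%:~R <= (1 - th) * k2] ->
   1 <= (1 + k0) * s i0 + (1 + k1) * s i1 + (1 + k2) * s i2) ->
  split_closure f (corner_rays u v w f) s.
Proof.
move=> T If s0 H; have [D lu lv lw [uv _ wu _]] := T.
apply: split_closure_intro => // a1 a2 b /andP[fb1 fb2] c0 c1 c2 c00 c10 c20.
have [e eE] := lin_int a1 a2 lu.
have [k kE] := lin_even a1 a2 lu lv uv.
have [l lE] := lin_even a1 a2 lw lu wu.
have fE := lin_bary a1 a2 f D.
have bs := bary_sum f D.
have bE : bary u v w f = 1 - bary v w u f - bary w u v f by lra.
have wE : lin a1 a2 w = e%:~R - 2 * l%:~R by lra.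
rewrite kE wE eE in fE *.
have [d [dE|dE]] := int_parity (e - b).
- have {}dE : e%:~R = b%:~R + 2 * d%:~R :> R.
    by apply/eqP; rewrite -subr_eq0 opprD addrA -intrB dE intrM subrr.
  pose th := lin a1 a2 f - b%:~R.
  have th01 : 0 < th < 1 by apply/andP; rewrite /th; split; lra.
  move=> u1 u2 v1 v2 w1 w2.
  have := H th (c0 - 1) (c1 - 1) (c2 - 1) d (d + k) (d - l) th01.
  rewrite ![1 + (_ - 1)]addrC !subrK; apply.
  + by rewrite intrD intrB /th fE dE bE; ring.
  + by apply: split_coef_excess => //; rewrite intrM /th; lra.
  + by apply: split_coef_excess => //; rewrite intrM intrD /th; lra.
  + by apply: split_coef_excess => //; rewrite intrM intrB /th; lra.
- have {}dE : e%:~R = b%:~R + 2 * d%:~R + 1 :> R.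
    by apply/eqP; rewrite -subr_eq0 !opprD !addrA -intrB dE intrD intrM -addrA -opprD subrr.
  pose th := b%:~R + 1 - lin a1 a2 f.
  have th01 : 0 < th < 1 by apply/andP; rewrite /th; split; lra.
  move=> u1 u2 v1 v2 w1 w2.
  have := H th (c0 - 1) (c1 - 1) (c2 - 1) (- d) (- d - k) (l - d) th01.
  rewrite ![1 + (_ - 1)]addrC !subrK; apply.
  + by rewrite !intrB mulrNz /th fE dE bE; ring.
  + by apply: split_coef_excess => //; rewrite intrM mulrNz /th; lra.
  + by apply: split_coef_excess => //; rewrite intrM intrB mulrNz /th; lra.
  + by apply: split_coef_excess => //; rewrite intrM intrB /th; lra.
Qed.

(** The two cuts add up to [2 * l1 * (1 - S) <= s2 + s3 <= S]; multiplication by [z - 1] gives the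
    claim. *)
Lemma corner_strength (l1 l2 l3 s1 s2 s3 z : R) : 1 < z ->
  l1 + l2 + l3 = 1 -> 0 < l2 -> 0 < l3 -> 0 <= s1 -> 2^-1 <= l1 ->
  1 <= 2 * (z - 1) * l1 ->
  (1 - (s1 + s2 + s3)) * (1 - 2 * l2) <= s2 ->
  (1 - (s1 + s2 + s3)) * (1 - 2 * l3) <= s3 ->
  1 <= z * (s1 + s2 + s3).
Proof.
move=> z1 ls l20 l30 s10 l12 zl h2 h3.
set S := s1 + s2 + s3 in h2 h3 *.
have [S1|S1] := leP 1 S; first nra.
have H : 2 * l1 * (1 - S) <= S.
  have : 0 <= (1 - S) * (1 - l1 - l2 - l3) by rewrite (_ : 1 - _ - _ - _ = 0) ?mulr0//; lra.
  rewrite /S in h2 h3 *; nra.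
have : (z - 1) * (2 * l1 * (1 - S)) <= (z - 1) * S by rewrite ler_pM2l//; lra.
have : 1 * (1 - S) <= 2 * (z - 1) * l1 * (1 - S) by rewrite ler_pM2r//; lra.
nra.
Qed.

Lemma type1_strength_le u v w f (z : R) : type1_at u v w -> interior (triangle u v w) f ->
  1 < z ->
  (2 <= z \/ (2^-1 <= bary u v w f /\ 1 <= 2 * (z - 1) * bary u v w f) \/
   (2^-1 <= bary v w u f /\ 1 <= 2 * (z - 1) * bary v w u f) \/
   (2^-1 <= bary w u v f /\ 1 <= 2 * (z - 1) * bary w u v f)) ->
  (strength_at u v w f <= z%:E)%E.
Proof.
move=> T If z1 H; have [D _ _ _ _] := T.
apply/(strength_leP D If (ltW z1)) => s Qs.
have /= [h1 h2 h3] := type1_cuts T If Qs; have [s0 _] := Qs.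
have bs := bary_sum f D.
have /(interior_triangleP _ D)[f1 f2 f3] := If.
have c1 : 2^-1 <= bary u v w f -> 1 <= 2 * (z - 1) * bary u v w f ->
    1 <= z * (s i0 + s i1 + s i2).
  move=> l z2; have {}h2 := h2 ltac:(lra); have {}h3 := h3 ltac:(lra).
  exact: (corner_strength z1 bs f2 f3 (s0 i0) l z2 h2 h3).
have c2 : 2^-1 <= bary v w u f -> 1 <= 2 * (z - 1) * bary v w u f ->
    1 <= z * (s i0 + s i1 + s i2).
  move=> l z2; have {}h1 := h1 ltac:(lra); have {}h3 := h3 ltac:(lra).
  rewrite [_ + s i1]addrC in h1 h3 *.
  by apply: (corner_strength z1 _ f1 f3 (s0 i1) l z2 h1 h3); rewrite -bs; ring.
have c3 : 2^-1 <= bary w u v f -> 1 <= 2 * (z - 1) * bary w u v f ->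
    1 <= z * (s i0 + s i1 + s i2).
  move=> l z2; have {}h1 := h1 ltac:(lra); have {}h2 := h2 ltac:(lra).
  rewrite [_ + s i2]addrC addrA in h1 h2 *.
  by apply: (corner_strength z1 _ f1 f2 (s0 i2) l z2 h1 h2); rewrite -bs; ring.
case: H => [z2|[[]//|[[]//|[]//]]].
have big (l : R) : 2^-1 <= l -> 1 <= 2 * (z - 1) * l.
  move=> l2; have : 0 <= (z - 2) * l by rewrite mulr_ge0; lra.
  lra.
have [/[dup] /big|l1] := leP 2^-1 (bary u v w f); first by move=> *; exact: c1.
have [/[dup] /big|l2] := leP 2^-1 (bary v w u f); first by move=> *; exact: c2.
have [/[dup] /big|l3] := leP 2^-1 (bary w u v f); first by move=> *; exact: c3.
have {}h1 := h1 l1; have {}h2 := h2 l2; have {}h3 := h3 l3.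
set S := s i0 + s i1 + s i2 in h1 h2 h3 *.
(* No coordinate reaches 1/2, so all three cuts are available, and they add up to [1 - S <= S]. *)
have : (1 - S) * (3 - 2 * (bary u v w f + bary v w u f + bary w u v f)) <= S by rewrite /S in h1 h2 h3 *; lra.
rewrite bs => S2; have : 0 <= (z - 2) * S by rewrite mulr_ge0; lra.
lra.
Qed.

Definition vec3 (a b c : R) : 'I_3 -> R :=
  fun j => match val j with 0%N => a | 1%N => b | _ => c end.

Lemma nonneg_vec3 (a b c : R) : 0 <= a -> 0 <= b -> 0 <= c -> nonneg3 (vec3 a b c).
Proof. by move=> *; case=> -[|[|[|]]]. Qed.

(** The entries sum to 1/2, and by [medial_excess] the excesses of the coefficients contribute at
    least another 1/2. *)
Lemma type1_medial_point u v w f : type1_at u v w -> interior (triangle u v w) f ->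
  bary u v w f < 2^-1 -> bary v w u f < 2^-1 -> bary w u v f < 2^-1 ->
  split_closure f (corner_rays u v w f)
    (vec3 (2^-1 - bary u v w f) (2^-1 - bary v w u f) (2^-1 - bary w u v f)).
Proof.
move=> T If l1 l2 l3; have [D _ _ _ _] := T; have bs := bary_sum f D.
apply: type1_split_closure => //; first by apply: nonneg_vec3; lra.
move=> th k0 k1 k2 m0 m1 m2 th01 thE [_ _ b0 d0] [_ _ b1 d1] [_ _ b2 d2].
have := medial_excess bs (ltW l1) (ltW l2) (ltW l3) th01 thE d0 b0 d1 b1 d2 b2.
rewrite /vec3 /=; lra.
Qed.

(** With [l] the large coordinate, the entries sum to [2 * l / (1 + 2 * l)], and [corner_excess]
    supplies the missing [1 / (1 + 2 * l)]. *)
Lemma type1_corner_points u v w f : type1_at u v w -> interior (triangle u v w) f ->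
  [/\ 2^-1 <= bary u v w f ->
    split_closure f (corner_rays u v w f) (vec3 0
      ((1 - 2 * bary v w u f) / (1 + 2 * bary u v w f))
      ((1 - 2 * bary w u v f) / (1 + 2 * bary u v w f))),
    2^-1 <= bary v w u f ->
    split_closure f (corner_rays u v w f) (vec3
      ((1 - 2 * bary u v w f) / (1 + 2 * bary v w u f)) 0
      ((1 - 2 * bary w u v f) / (1 + 2 * bary v w u f))) &
    2^-1 <= bary w u v f ->
    split_closure f (corner_rays u v w f) (vec3
      ((1 - 2 * bary u v w f) / (1 + 2 * bary w u v f))
      ((1 - 2 * bary v w u f) / (1 + 2 * bary w u v f)) 0)].
Proof.
move=> T If; have [D _ _ _ _] := T; have bs := bary_sum f D.
have /(interior_triangleP _ D)[f1 f2 f3] := If.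
have fin (l1 l2 l3 k2 k3 : R) : l1 + l2 + l3 = 1 -> 0 < l1 ->
    1 <= (1 - 2 * l2) * k2 + (1 - 2 * l3) * k3 ->
    1 <= (1 + k2) * ((1 - 2 * l2) / (1 + 2 * l1)) + (1 + k3) * ((1 - 2 * l3) / (1 + 2 * l1)).
  by move=> ? ? ?; rewrite !mulrA -mulrDl ler_pdivlMr; lra.
split=> l; apply: type1_split_closure => //; try (apply: nonneg_vec3 => //; apply: divr_ge0; lra);
  move=> th k0 k1 k2 m0 m1 m2 th01 thE [a0 b0 c0 d0] [a1 b1 c1 d1] [a2 b2 c2 d2];
  rewrite /vec3 /= mulr0 ?add0r ?addr0; apply: fin => //.
- by have := corner_excess bs l f2 f3 th01 thE a1 b1 c1 d1 a2 b2 c2 d2.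
- by rewrite -bs; ring.
- have bs' : bary v w u f + bary u v w f + bary w u v f = 1 by rewrite -bs; ring.
  have thE' : 2 * (bary v w u f * m1%:~R + bary u v w f * m0%:~R + bary w u v f * m2%:~R) = th.
    by rewrite -thE; ring.
  by have := corner_excess bs' l f1 f3 th01 thE' a0 b0 c0 d0 a2 b2 c2 d2.
- by rewrite -bs; ring.
- have bs' : bary w u v f + bary u v w f + bary v w u f = 1 by rewrite -bs; ring.
  have thE' : 2 * (bary w u v f * m2%:~R + bary u v w f * m0%:~R + bary v w u f * m1%:~R) = th.
    by rewrite -thE; ring.
  by have := corner_excess bs' l f1 f2 th01 thE' a0 b0 c0 d0 a1 b1 c1 d1.
Qed.

(** The criterion is tested at the explicit points. The sum 1/2 in the medial case contradicts
    [z < 2]; the corner points give the stated inequalities. *)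
Lemma type1_strength_gt u v w f (z : R) : type1_at u v w -> interior (triangle u v w) f ->
  1 < z -> z < 2 -> (strength_at u v w f <= z%:E)%E ->
  1 <= 2 * (z - 1) * bary u v w f \/ 1 <= 2 * (z - 1) * bary v w u f \/
  1 <= 2 * (z - 1) * bary w u v f.
Proof.
move=> T If z1 z2; have [D _ _ _ _] := T; have bs := bary_sum f D.
move=> /(strength_leP D If (ltW z1)) H.
have [c1 c2 c3] := type1_corner_points T If.
have fin (l1 l2 l3 : R) : l1 + l2 + l3 = 1 -> 2^-1 <= l1 ->
   1 <= z * ((1 - 2 * l2) / (1 + 2 * l1) + (1 - 2 * l3) / (1 + 2 * l1)) -> 1 <= 2 * (z - 1) * l1.
  move=> ls l12; rewrite -mulrDl mulrA ler_pdivlMr; last lra.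
  have -> : l1 = 1 - l2 - l3 by lra.
  lra.
have [/[dup] /c1 Q l|l1] := leP 2^-1 (bary u v w f).
  by left; apply: (fin _ _ _ bs l); have := H _ Q; rewrite /vec3 /= add0r.
have [/[dup] /c2 Q l|l2] := leP 2^-1 (bary v w u f).
  right; left; apply: (fin _ (bary u v w f) (bary w u v f) _ l); first by rewrite -bs; ring.
  by have := H _ Q; rewrite /vec3 /= addr0.
have [/[dup] /c3 Q l|l3] := leP 2^-1 (bary w u v f).
  right; right; apply: (fin _ (bary u v w f) (bary v w u f) _ l); first by rewrite -bs; ring.
  by have := H _ Q; rewrite /vec3 /= addr0.
have := H _ (type1_medial_point T If l1 l2 l3); rewrite /vec3 /= => K.
have {}bs : 2^-1 - bary u v w f + (2^-1 - bary v w u f) + (2^-1 - bary w u v f) = 2^-1 by lra.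
rewrite bs in K; lra.
Qed.

End Type1.

(** * The probability for triangles of type 1 *)

Section Type1Probability.
Context {R : realType}.
Implicit Types (u v w x f : R * R).
Local Notation T1 := (measurableTypeR R).

Lemma area_triangle u v w : orient u v w != 0 ->
  area (triangle u v w) = (`|orient u v w| * simplex_area)%:E.
Proof.
move=> D; rewrite (area_corner (u := u) (v := v) (w := w) (t := 0))//.
- by rewrite subr0 expr1n mulr1.
- by move=> x /= [? ? ?]; apply/(triangleP _ D); split; exact: ltW.
- by move=> x /(triangleP _ D).
Qed.

Lemma area_interior_triangle u v w : orient u v w != 0 ->
  area (interior (triangle u v w)) = (`|orient u v w| * simplex_area)%:E.
Proof.
move=> D; rewrite (area_corner (u := u) (v := v) (w := w) (t := 0))//.
- by rewrite subr0 expr1n mulr1.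
- by move=> x /= ?; apply/(interior_triangleP _ D).
- by move=> x /(interior_triangleP _ D)[? ? ?]; split; exact: ltW.
Qed.

Lemma probPE u v w (z c : R) : orient u v w != 0 ->
  area [set f | interior (triangle u v w) f /\ (strength_at u v w f <= z%:E)%E] =
    (c * (`|orient u v w| * simplex_area))%:E ->
  probP u v w z = c%:E.
Proof.
move=> D E; rewrite /probP area_triangle// /= -/(strength_at _ _ _ _).
have -> : forall A, A = (c * (`|orient u v w| * simplex_area))%:E ->
  (A * (`|orient u v w| * simplex_area)^-1%:E)%E = c%:E.
- move=> A ->; rewrite -EFinM mulfK// mulf_neq0 ?normr_eq0// gt_eqF//; exact: simplex_area_gt0.
- by [].
- exact: E.
Qed.

Lemma measurable_bary_gt u v w (t : R) : orient u v w != 0 ->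
  measurable ([set x | t < bary u v w x] : set (T1 * T1)).
Proof.
move=> D.
have := measurable_halfplane ((v.2 - w.2) / orient u v w) ((w.1 - v.1) / orient u v w)
  ((v.1 * w.2 - v.2 * w.1) / orient u v w - t).
congr measurable; apply: eq_set => x.
by rewrite addrA -bary_affine// subr_gt0.
Qed.

Lemma measurable_bary_ge u v w (t : R) : orient u v w != 0 ->
  measurable ([set x | t <= bary u v w x] : set (T1 * T1)).
Proof.
move=> D; have D' : orient u w v != 0.
  by apply: contraNneq D => H; apply/eqP; move: H; rewrite /orient; lra.
have -> : [set x | t <= bary u v w x] = ~` [set x | bary u v w x < t].
  by apply/seteqP; split => x /=; rewrite leNgt => /negP.
apply: measurableC.
have := measurable_halfplane (- ((v.2 - w.2) / orient u v w)) (- ((w.1 - v.1) / orient u v w))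
  (t - (v.1 * w.2 - v.2 * w.1) / orient u v w).
congr measurable; apply: eq_set => x.
rewrite (bary_affine x D) -[in RHS]subr_gt0; congr (0 < _); ring.
Qed.

(** For [z < 2] the condition is that some coordinate is at least [t = 1 / (2 * (z - 1))]. This is
    impossible when [t >= 1]; otherwise [t > 1/2] makes the three corners disjoint, each of relative
    area [(1 - t) ^+ 2]. *)
Lemma type1_probability u v w (z : R) : type1_at u v w -> 1 < z ->
  probP u v w z =
       (if z <= 3 / 2 then 0
        else if z < 2 then 3 / 4 * ((2 * z - 3) / (z - 1)) ^+ 2
        else 1)%:E.
Proof.
move=> T z1; have [D _ _ _ _] := T.
have D1 := orient_rot_neq0 D; have D2 := orient_rot_neq0 D1.
apply: probPE => //.
case: ifPn => [z32|]; last rewrite -ltNge => z32.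
  rewrite mul0r (_ : [set f | _] = set0); first by rewrite /area measure0.
  rewrite -subset0 => f [If /(type1_strength_gt T If z1)] /(_ ltac:(lra)) H /=.
  have /(interior_triangleP _ D)[f1 f2 f3] := If; have bs := bary_sum f D.
  have small (l : R) : 0 < l -> l < 1 -> 1 <= 2 * (z - 1) * l -> False.
    move=> l0 l1; have : 0 <= (3 / 2 - z) * l by rewrite mulr_ge0; lra.
    lra.
  by case: H => [|[|]]; apply: small => //; lra.
case: ifPn => [z2|]; last rewrite -leNgt => z2.
  pose t := (2 * (z - 1))^-1.
  have tE (l : R) : (1 <= 2 * (z - 1) * l) = (t <= l).
    by rewrite /t -ler_pdivrMl ?mulr1//; lra.
  have t2 : 2^-1 < t by rewrite ltf_pV2 ?posrE; lra.
  have t1 : t < 1 by rewrite invf_lt1; lra.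
  pose C u v w := [set x | [/\ t <= bary u v w x, 0 < bary v w u x & 0 < bary w u v x]].
  have mC u' v' w' : orient u' v' w' != 0 -> measurable (C u' v' w' : set (T1 * T1)).
    move=> D'; have D1' := orient_rot_neq0 D'; have D2' := orient_rot_neq0 D1'.
    have -> : C u' v' w' = [set x | t <= bary u' v' w' x] `&` [set x | 0 < bary v' w' u' x]
         `&` [set x | 0 < bary w' u' v' x].
      by apply/seteqP; split => x /=; [move=> [? ? ?]|move=> [[? ?] ?]].
    by do ?apply: measurableI; [exact: measurable_bary_ge|exact: measurable_bary_gt|exact: measurable_bary_gt].
  have aC u' v' w' : orient u' v' w' != 0 -> area (C u' v' w') = (`|orient u' v' w'| * (1 - t) ^+ 2 * simplex_area)%:E.
    move=> D'; apply: area_corner => //; first by move=> x [? ? ?]; split => //; exact: ltW.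
    by move=> x [? ? ?]; split => //; exact: ltW.
  have -> : [set f | (triangle u v w)° f /\ (strength_at u v w f <= z%:E)%E] =
     C u v w `|` C v w u `|` C w u v.
    apply/seteqP; split => f.
      move=> [If /(type1_strength_gt T If z1 z2)]; rewrite !tE.
      have /(interior_triangleP _ D)[f1 f2 f3] := If.
      by case=> [|[|]] ?; [left; left|left; right|right].
    have bs := bary_sum f D.
    have use : (triangle u v w)° f -> (t <= bary u v w f \/ t <= bary v w u f \/ t <= bary w u v f) ->
        (triangle u v w)° f /\ (strength_at u v w f <= z%:E)%E.
      move=> If H; split => //; apply: type1_strength_le => //; right.
      rewrite !tE; case: H => [|[|]] ?; [left|right; left|right; right]; split; lra.
    case=> [[|]|] [a b c]; apply: use; rewrite ?interior_triangleP//; try by [split => //; lra].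
    - by left.
    - by right; left.
    - by right; right.
  rewrite /area measureU; last 3 first.
  - by apply: measurableU; exact: mC.
  - exact: mC.
  - rewrite -subset0 => x [[|] [? ? ?] [? ? ?]] /=; have := bary_sum x D; lra.
  rewrite measureU; last 3 first.
  - exact: mC.
  - exact: mC.
  - rewrite -subset0 => x [[? ? ?] [? ? ?]] /=; have := bary_sum x D; lra.
  transitivity (area (C u v w) + area (C v w u) + area (C w u v))%E; first by [].
  rewrite !aC// -!EFinD; congr EFin.
  rewrite (orient_rot u v w) -(orient_rot w u v) /t; field; lra.
rewrite mul1r -area_interior_triangle//; congr area.
apply/seteqP; split => [f []//|f If]; split => //.
by apply: type1_strength_le => //; left.
Qed.

End Type1Probability.

(** * Unimodular normal form of a type 2 triangle *)

Section Type2NormalForm.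
Context {R : realType}.
Implicit Types (a b v p q x w : R * R).

(** Cramer's rule, where the determinant [d] is its own inverse. *)
Lemma unimodular_point (x1 x2 y1 y2 i j : int) :
  x1 * y2 - x2 * y1 = 1 \/ x1 * y2 - x2 * y1 = -1 ->
  exists w : R * R, [/\ is_lattice w, lin x1 x2 w = i%:~R & lin y1 y2 w = j%:~R].
Proof.
have key (d : int) : d * d = 1 -> x1 * y2 - x2 * y1 = d ->
    exists w : R * R, [/\ is_lattice w, lin x1 x2 w = i%:~R & lin y1 y2 w = j%:~R].
  move=> dd dE; exists ((d * (y2 * i - x2 * j))%:~R, (d * (x1 * j - y1 * i))%:~R).
  split; first by split; eexists.
    rewrite /lin /= -!intrM -intrD; congr (_%:~R).
    by transitivity (d * (x1 * y2 - x2 * y1) * i); [ring|rewrite dE dd mul1r].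
  rewrite /lin /= -!intrM -intrD; congr (_%:~R).
  by transitivity (d * (x1 * y2 - x2 * y1) * j); [ring|rewrite dE dd mul1r].
by case; apply: key.
Qed.

Lemma primitive_direction (d1 d2 : int) : (d1, d2) != (0, 0) ->
  exists g e1 e2 s t : int, [/\ 1 <= g, d1 = e1 * g, d2 = e2 * g & s * e1 + t * e2 = 1].
Proof.
move=> d0; have [s [t st]] := Bezoutz d1 d2.
have g0 : gcdz d1 d2 != 0.
  by apply: contra d0 => /eqP H; move: H => /eqP; rewrite gcdz_eq0 => /andP[/eqP-> /eqP->].
exists (gcdz d1 d2), (d1 %/ gcdz d1 d2)%Z, (d2 %/ gcdz d1 d2)%Z, s, t.
have E1 : d1 = (d1 %/ gcdz d1 d2)%Z * gcdz d1 d2 by rewrite divzK// dvdz_gcdl.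
have E2 : d2 = (d2 %/ gcdz d1 d2)%Z * gcdz d1 d2 by rewrite divzK// dvdz_gcdr.
split => //.
  by rewrite -gtz0_ge1 lt_neqAle eq_sym g0.
by apply: (mulIf g0); rewrite mulrDl -!mulrA -E1 -E2 st mul1r.
Qed.

(** The primitive vector [(e1, e2)] along the base yields [Y], constant on the base, and a Bezout
    functional [X] with value 1 on that vector. Abscissas are measured from the first lattice point;
    the second is at distance [g >= 1], whence [al <= 0] and [be >= 1]. *)
Lemma lattice_base_coord v a b p q : orient v a b != 0 -> p <> q ->
  is_lattice p -> is_lattice q -> segment a b p -> segment a b q ->
  exists x1 x2 xc y1 y2 yc : int, exists h al be xi : R,
  [/\ x1 * y2 - x2 * y1 = 1 \/ x1 * y2 - x2 * y1 = -1, 0 < h, al <= 0 & 1 <= be] /\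
  [/\ lin y1 y2 a = yc%:~R, lin y1 y2 b = yc%:~R & lin y1 y2 v = yc%:~R + h] /\
  [/\ lin x1 x2 a = xc%:~R + al, lin x1 x2 b = xc%:~R + be & lin x1 x2 v = xc%:~R + xi].
Proof.
move=> D pq lp lq [tp [/andP[tp0 tp1] pE]] [tq [/andP[tq0 tq1] qE]].
wlog tpq : p q tp tq pq lp lq tp0 tp1 pE tq0 tq1 qE / tp < tq.
  move=> hw; have [|tqp|tt] := ltgtP tp tq.
  - exact: (hw p q tp tq).
  - by apply: (hw q p tq tp) => // qp; apply: pq.
  - by case: pq; rewrite pE qE tt.
have [[p1 p1E] [p2 p2E]] := lp; have [[q1 q1E] [q2 q2E]] := lq.
have d0 : (q1 - p1, q2 - p2) != (0, 0).
  apply/eqP => -[/eqP + /eqP]; rewrite !subr_eq0 => /eqP e1 /eqP e2; apply: pq.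
  by rewrite [LHS]surjective_pairing [RHS]surjective_pairing p1E p2E q1E q2E e1 e2.
have [g [e1 [e2 [s [t [g1 d1E d2E st]]]]]] := primitive_direction d0.
have dt : 0 < tq - tp by lra.
have E1 : (tq - tp) * (b.1 - a.1) = e1%:~R * g%:~R.
  by rewrite -intrM -d1E intrB -p1E -q1E pE qE /padd /pscale /=; ring.
have E2 : (tq - tp) * (b.2 - a.2) = e2%:~R * g%:~R.
  by rewrite -intrM -d2E intrB -p2E -q2E pE qE /padd /pscale /=; ring.
(* Length of the base in primitive vectors: the fraction [tq - tp] of it accounts for [g] of
   them. *)
pose L : R := g%:~R / (tq - tp).
have gR : 1 <= g%:~R :> R by rewrite ler1z.
have L0 : 0 < L by rewrite divr_gt0//; lra.
have LE : (tq - tp) * L = g%:~R by rewrite /L mulrCA mulfV ?mulr1// gt_eqF.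
have B1 : b.1 - a.1 = e1%:~R * L.
  by apply: (mulfI (lt0r_neq0 dt)); rewrite E1 mulrCA LE.
have B2 : b.2 - a.2 = e2%:~R * L.
  by apply: (mulfI (lt0r_neq0 dt)); rewrite E2 mulrCA LE.
have stR : s%:~R * e1%:~R + t%:~R * e2%:~R = 1 :> R by rewrite -!intrM -intrD st.
pose Y v := e1%:~R * v.2 - e2%:~R * v.1 : R.
have YE : L * (Y v - Y a) = orient v a b.
  rewrite /orient /Y.
  have -> : b.1 = a.1 + e1%:~R * L by lra.
  have -> : b.2 = a.2 + e2%:~R * L by lra.
  ring.
have Ya : Y a = (e1 * p2 - e2 * p1)%:~R.
  rewrite intrB !intrM -p1E -p2E pE /padd /pscale /=.
  have -> : b.1 = a.1 + e1%:~R * L by lra.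
  have -> : b.2 = a.2 + e2%:~R * L by lra.
  rewrite /Y; ring.
have Yb : Y b = Y a.
  rewrite /Y.
  have -> : b.1 = a.1 + e1%:~R * L by lra.
  have -> : b.2 = a.2 + e2%:~R * L by lra.
  ring.
have Yv : Y v - Y a != 0.
  by apply: contraNneq D => H; rewrite -YE H mulr0.
have Xp : lin s t p = (s * p1 + t * p2)%:~R by rewrite /lin p1E p2E intrD !intrM.
have Xa : lin s t a = lin s t p + - (tp * L).
  rewrite pE /lin /padd /pscale /=.
  have -> : b.1 = a.1 + e1%:~R * L by lra.
  have -> : b.2 = a.2 + e2%:~R * L by lra.
  have -> : tp * L = tp * ((s%:~R * e1%:~R + t%:~R * e2%:~R) * L) by rewrite stR mul1r.
  ring.
have Xb : lin s t b = lin s t p + (1 - tp) * L.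
  rewrite pE /lin /padd /pscale /=.
  have -> : b.1 = a.1 + e1%:~R * L by lra.
  have -> : b.2 = a.2 + e2%:~R * L by lra.
  have -> : (1 - tp) * L = (1 - tp) * ((s%:~R * e1%:~R + t%:~R * e2%:~R) * L) by rewrite stR mul1r.
  ring.
have be1 : 1 <= (1 - tp) * L.
  have : (tq - tp) * L <= (1 - tp) * L by rewrite ler_wpM2r//; lra.
  lra.
have al0 : - (tp * L) <= 0 by rewrite oppr_le0 mulr_ge0// ltW.
(* The sign of [Y] is chosen to put the apex above the base; reversing it makes the determinant
   -1. *)
have [Ypos|Yneg] := ltP 0 (Y v - Y a).
  exists s, t, (s * p1 + t * p2), (- e2), e1, (e1 * p2 - e2 * p1).
  exists (Y v - Y a), (- (tp * L)), ((1 - tp) * L), (lin s t v - lin s t p).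
  split; first by split => //; left; rewrite -st; ring.
  have linY x : lin (- e2) e1 x = Y x by rewrite /lin /Y mulrNz; ring.
  rewrite !linY Yb -Ya Xa Xb -Xp; split; split => //; ring.
exists s, t, (s * p1 + t * p2), e2, (- e1), (e2 * p1 - e1 * p2).
exists (Y a - Y v), (- (tp * L)), ((1 - tp) * L), (lin s t v - lin s t p).
split.
  split => //; first by right; rewrite -st; ring.
  have : Y v - Y a < 0 by rewrite lt_neqAle Yv.
  lra.
have linY x : lin e2 (- e1) x = - Y x by rewrite /lin /Y mulrNz; ring.
have -> : (e2 * p1 - e1 * p2)%:~R = - Y a by rewrite Ya -mulrNz opprB.
rewrite !linY Yb Xa Xb -Xp; split; split => //; ring.
Qed.

(** The lattice points on the slanted edges have integral heights strictly between 0 and [h], so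
    [h > 1]. Lattice-freeness confines the chord at height 1 to [[k, k + 1]], the two points force
    it to fill this interval, and a shear moves it to [[0, 1]]. The relation between [l], [r] and
    [h] says that the chord has length 1. *)
Lemma type2_normal_form v a b : orient v a b != 0 -> type2_at v a b ->
  (forall x, is_lattice x -> ~ interior (triangle v a b) x) ->
  exists x1 x2 xc y1 y2 yc : int, exists h l r : R,
  [/\ x1 * y2 - x2 * y1 = 1 \/ x1 * y2 - x2 * y1 = -1, 1 < h, 0 <= l, 0 <= r &
      (l + r) * (h - 1) = 1] /\
  [/\ lin y1 y2 a = yc%:~R, lin y1 y2 b = yc%:~R & lin y1 y2 v = yc%:~R + h] /\
  [/\ lin x1 x2 a = xc%:~R - l, lin x1 x2 b = xc%:~R + 1 + r &
      lin x1 x2 v = xc%:~R + l * (h - 1)].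
Proof.
move=> D [_ [p [[lp [tp [/andP[tp0 tp1] pE]]] _]] [q [[lq [tq [/andP[tq0 tq1] qE]]] _]]].
move=> [p' [q' [pq' lp' lq' sp' sq']]] free.
have [x1 [x2 [xc [y1 [y2 [yc [h [al [be [xi]]]]]]]]]] := lattice_base_coord D pq' lp' lq' sp' sq'.
move=> [[det h0 al0 be1] [[Ya Yb Yv] [Xa Xb Xv]]].
have [D1 D2] : orient a b v != 0 /\ orient b v a != 0.
  by split; do ?exact: orient_rot_neq0 => //; apply: orient_rot_neq0; exact: orient_rot_neq0.
have [n nE] := lin_int y1 y2 lp; have [m mE] := lin_int y1 y2 lq.
have [i iE] := lin_int x1 x2 lp; have [j jE] := lin_int x1 x2 lq.
have lin_comb c1 c2 (s t : R) x y : lin c1 c2 (padd (pscale s x) (pscale t y)) =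
    s * lin c1 c2 x + t * lin c1 c2 y by rewrite /lin /padd /pscale /=; ring.
have nE' : (n - yc)%:~R = (1 - tp) * h by rewrite intrB -nE pE lin_comb Ya Yv; ring.
have mE' : (m - yc)%:~R = (1 - tq) * h by rewrite intrB -mE qE lin_comb Yb Yv; ring.
have n1 : 1 <= (n - yc)%:~R :> R.
  by rewrite ler1z -gtz0_ge1 -(ltr0z R) nE' mulr_gt0//; lra.
have m1 : 1 <= (m - yc)%:~R :> R.
  by rewrite ler1z -gtz0_ge1 -(ltr0z R) mE' mulr_gt0//; lra.
have nh : (n - yc)%:~R < h by rewrite nE'; nra.
have mh : (m - yc)%:~R < h by rewrite mE'; nra.
have h1 : 1 < h by lra.
(* [al + c] and [be + d] are the ends of the chord at height 1 *)
pose c := (xi - al) / h; pose d := (xi - be) / h.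
have cE : xi = al + c * h by rewrite /c divfK ?gt_eqF//; lra.
have dE : xi = be + d * h by rewrite /d divfK ?gt_eqF//; lra.
have cd : al + c < be + d.
  have H1 : (be - al) = (c - d) * h by lra.
  have H2 : 0 < (c - d) by rewrite -(pmulr_lgt0 _ h0); lra.
  nra.
have [k /andP[k0 k1]] := floor_frac (al + c).
(* Otherwise the lattice point of abscissa [k + 1] at height 1 would be interior. *)
have kd : be + d <= k%:~R + 1.
  rewrite leNgt; apply/negP => kd.
  have [w [lw wx wy]] := unimodular_point (xc + k + 1) (yc + 1) det.
  apply: (free w lw); apply/(interior_triangleP _ D).
  have := lin_bary x1 x2 w D; have := lin_bary y1 y2 w D; have := bary_sum w D.
  rewrite Xa Xb Xv Ya Yb Yv wx wy !intrD.
  set A := bary v a b w; set B := bary a b v w; set C := bary b v a w.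
  move=> S HY HX.
  have Ah : A * h = 1.
    have : (A + B + C) * yc%:~R = yc%:~R by rewrite S mul1r.
    lra.
  have A0 : 0 < A by rewrite -(pmulr_lgt0 _ h0) Ah.
  have HX' : k%:~R + 1 = A * xi + B * al + C * be.
    have : (A + B + C) * xc%:~R = xc%:~R by rewrite S mul1r.
    lra.
  have Axc : A * xi = A * al + c by rewrite cE mulrDr mulrCA Ah mulr1.
  have Axd : A * xi = A * be + d by rewrite dE mulrDr mulrCA Ah mulr1.
  have ba : 0 < be - al by lra.
  have SA : (A + B + C) * al = al by rewrite S mul1r.
  have SB : (A + B + C) * be = be by rewrite S mul1r.
  split=> //; rewrite -(pmulr_lgt0 _ ba); lra.
have Xp : (i - xc)%:~R = al + (n - yc)%:~R * c.
  rewrite intrB -iE pE lin_comb Xa Xv nE' cE; ring.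
have Xq : (j - xc)%:~R = be + (m - yc)%:~R * d.
  rewrite intrB -jE qE lin_comb Xb Xv mE' dE; ring.
pose K : R := k%:~R.
have hc : c - d = (be - al) / h by rewrite /c /d -mulrBl; congr (_ / _); lra.
have cd0 : 0 < c - d by rewrite hc divr_gt0//; lra.
have cdh : (c - d) * h = be - al by rewrite hc divfK// gt_eqF.
(* both lattice points have abscissa in [0, 1], measured along the sheared axis *)
have Hc : al + c = K.
  have lo : 0 <= (n - yc)%:~R * (al + c - K) + ((n - yc)%:~R - 1) * - al.
    by apply: addr_ge0; apply: mulr_ge0; rewrite /K; lra.
  have hi : (n - yc)%:~R * (be + d - K) - ((n - yc)%:~R - 1) * be <= 1.
    have H1 : (n - yc)%:~R * (be + d - K) <= (n - yc)%:~R * 1 by apply: ler_wpM2l; rewrite /K; lra.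
    have H2 : ((n - yc)%:~R - 1) * 1 <= ((n - yc)%:~R - 1) * be by apply: ler_wpM2l; lra.
    lra.
  have gap : al + (n - yc)%:~R * c < be + (n - yc)%:~R * d.
    have : (n - yc)%:~R * (c - d) < h * (c - d) by rewrite ltr_pM2r.
    lra.
  (* This integer is nonnegative by [lo] and less than 1 by [gap] and [hi]. Its vanishing makes both
     nonnegative terms of [lo] vanish. *)
  have z0 : i - xc - k * (n - yc) = 0.
    apply/eqP; rewrite eq_le; apply/andP; split.
      by rewrite -ltzD1 add0r -(ltrz1 R) intrB intrM Xp -/K; lra.
    by rewrite -(ler0z R) intrB intrM Xp -/K; lra.
  have : (i - xc - k * (n - yc))%:~R = 0 :> R by rewrite z0.
  rewrite intrB intrM Xp -/K => H.
  have H1 : (n - yc)%:~R * (al + c - K) <= 0.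
    have : 0 <= ((n - yc)%:~R - 1) * - al by apply: mulr_ge0; lra.
    lra.
  have : 1 * (al + c - K) <= (n - yc)%:~R * (al + c - K) by apply: ler_wpM2r; rewrite /K; lra.
  rewrite /K in H1 *; lra.
have Hd : be + d = K + 1.
  have lo : 0 <= (m - yc)%:~R * (al + c - K) + ((m - yc)%:~R - 1) * - al.
    by apply: addr_ge0; apply: mulr_ge0; rewrite /K; lra.
  have hi : (m - yc)%:~R * (be + d - K) - ((m - yc)%:~R - 1) * be <= 1.
    have H1 : (m - yc)%:~R * (be + d - K) <= (m - yc)%:~R * 1 by apply: ler_wpM2l; rewrite /K; lra.
    have H2 : ((m - yc)%:~R - 1) * 1 <= ((m - yc)%:~R - 1) * be by apply: ler_wpM2l; lra.
    lra.
  have gap : al + (m - yc)%:~R * c < be + (m - yc)%:~R * d.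
    have : (m - yc)%:~R * (c - d) < h * (c - d) by rewrite ltr_pM2r.
    lra.
  have z1 : 1 <= j - xc - k * (m - yc).
    by rewrite -gtz0_ge1 -(ltr0z R) intrB intrM Xq -/K; lra.
  have : 1 <= (j - xc - k * (m - yc))%:~R :> R by rewrite ler1z.
  rewrite intrB intrM Xq -/K => H.
  have H2 : ((m - yc)%:~R - 1) * 1 <= ((m - yc)%:~R - 1) * be by apply: ler_wpM2l; lra.
  have : (m - yc)%:~R * 1 <= (m - yc)%:~R * (be + d - K) by lra.
  rewrite ler_pM2l; last lra.
  rewrite /K; lra.
(* The shear [X - k * Y] fixes the base abscissas up to the shift of origin and sends the chord at
   height 1 to [[0, 1]]. *)
exists (x1 - k * y1), (x2 - k * y2), (xc - k * yc), y1, y2, yc, h, (- al), (be - 1).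
have linX x : lin (x1 - k * y1) (x2 - k * y2) x = lin x1 x2 x - K * lin y1 y2 x.
  by rewrite /lin !intrB !intrM; ring.
split; [split => //|split; [by []|]].
- have -> : (x1 - k * y1) * y2 - (x2 - k * y2) * y1 = x1 * y2 - x2 * y1 by ring.
  exact: det.
- lra.
- lra.
- have E : c - d = be - al - 1 by lra.
  rewrite E in cdh; lra.
- have cK : c = K - al by lra.
  by rewrite !linX Xa Xb Xv Ya Yb Yv !intrB intrM -/K cE cK; split; ring.
Qed.

End Type2NormalForm.

(** * Lattice width in the normal form *)

Section LatticeWidth.
Context {R : realType}.
Implicit Types (a b v u w x : R * R).

Definition image_lin (u1 u2 : int) (B : set (R * R)) : set R :=
  [set dot (u1%:~R, u2%:~R) x | x in B].

Lemma triangle_vertices u v w :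
  [/\ triangle u v w u, triangle u v w v & triangle u v w w].
Proof.
by split; [exists 1, 0, 0|exists 0, 1, 0|exists 0, 0, 1]; split => //;
  rewrite ?addr0 ?add0r// [LHS]surjective_pairing /padd /pscale /=; congr pair; ring.
Qed.

Lemma image_lin_le (u1 u2 : int) u v w (hi : R) :
  lin u1 u2 u <= hi -> lin u1 u2 v <= hi -> lin u1 u2 w <= hi ->
  ubound (image_lin u1 u2 (triangle u v w)) hi.
Proof.
move=> hu hv hw _ [_ [p [q [r [p0 q0 r0 s ->]]]] <-].
have -> : dot (u1%:~R, u2%:~R) (padd (padd (pscale p u) (pscale q v)) (pscale r w)) =
  p * lin u1 u2 u + q * lin u1 u2 v + r * lin u1 u2 w.
  by rewrite /dot /lin /padd /pscale /=; ring.
have H1 := ler_wpM2l p0 hu; have H2 := ler_wpM2l q0 hv; have H3 := ler_wpM2l r0 hw.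
have : (p + q + r) * hi = hi by rewrite s mul1r.
lra.
Qed.

Lemma image_lin_ge (u1 u2 : int) u v w (lo : R) :
  lo <= lin u1 u2 u -> lo <= lin u1 u2 v -> lo <= lin u1 u2 w ->
  lbound (image_lin u1 u2 (triangle u v w)) lo.
Proof.
move=> hu hv hw _ [x Tx <-].
have linN y : lin (- u1) (- u2) y = - lin u1 u2 y by rewrite /lin !mulrNz; ring.
have := @image_lin_le (- u1) (- u2) u v w (- lo).
rewrite !linN !lerN2 => /(_ hu hv hw (- lin u1 u2 x)).
rewrite lerN2; apply; exists x => //.
by rewrite -linN.
Qed.

Lemma image_lin_width_ge (u1 u2 : int) (p q : R * R) u v w :
  triangle u v w p -> triangle u v w q ->
  `|lin u1 u2 p - lin u1 u2 q| <=
  sup (image_lin u1 u2 (triangle u v w)) - inf (image_lin u1 u2 (triangle u v w)).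
Proof.
move=> Tp Tq.
pose hi := `|lin u1 u2 u| + `|lin u1 u2 v| + `|lin u1 u2 w|.
have n (y : R) : [/\ 0 <= `|y|, y <= `|y| & - `|y| <= y].
  by rewrite normr_ge0 ler_norm lerNl -normrN ler_norm.
have [? ? ?] := n (lin u1 u2 u); have [? ? ?] := n (lin u1 u2 v); have [? ? ?] := n (lin u1 u2 w).
have hs : has_ubound (image_lin u1 u2 (triangle u v w)).
  by exists hi; apply: image_lin_le; rewrite /hi; lra.
have hl : has_lbound (image_lin u1 u2 (triangle u v w)).
  by exists (- hi); apply: image_lin_ge; rewrite /hi; lra.
have val x : triangle u v w x -> image_lin u1 u2 (triangle u v w) (lin u1 u2 x) by move=> ?; exists x.
have sp := ub_le_sup hs (val _ Tp); have sq := ub_le_sup hs (val _ Tq).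
have ip := ge_inf hl (val _ Tp); have iq := ge_inf hl (val _ Tq).
by rewrite ler_norml; apply/andP; split; lra.
Qed.

Lemma image_lin_width (u1 u2 : int) (p q : R * R) (lo hi : R) u v w :
  triangle u v w p -> triangle u v w q -> lin u1 u2 p = lo -> lin u1 u2 q = hi ->
  [/\ lo <= lin u1 u2 u, lo <= lin u1 u2 v & lo <= lin u1 u2 w] ->
  [/\ lin u1 u2 u <= hi, lin u1 u2 v <= hi & lin u1 u2 w <= hi] ->
  sup (image_lin u1 u2 (triangle u v w)) - inf (image_lin u1 u2 (triangle u v w)) = hi - lo.
Proof.
move=> Tp Tq pE qE [l1 l2 l3] [h1 h2 h3].
have ub := image_lin_le h1 h2 h3; have lb := image_lin_ge l1 l2 l3.
apply/eqP; rewrite eq_le; apply/andP; split; last first.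
  apply: le_trans (image_lin_width_ge u1 u2 Tq Tp).
  by rewrite pE qE ler_norm.
by apply: lerB; [apply: ge_sup|apply: lb_le_inf] => //; exists (lin u1 u2 p), p.
Qed.

(** Every integral functional is [P * X + Q * Y]. If [P] is nonzero it already varies by at least
    [1 + l + r] along the base; otherwise it is a nonzero multiple of [Y] and varies by at least
    [h]. The functionals [X] and [Y] attain these values. *)
Lemma lattice_width_unimodular (x1 x2 xc y1 y2 yc : int) (h l r : R) v a b :
  x1 * y2 - x2 * y1 = 1 \/ x1 * y2 - x2 * y1 = -1 -> 1 < h -> 0 <= l -> 0 <= r ->
  (l + r) * (h - 1) = 1 ->
  lin y1 y2 a = yc%:~R -> lin y1 y2 b = yc%:~R -> lin y1 y2 v = yc%:~R + h ->
  lin x1 x2 a = xc%:~R - l -> lin x1 x2 b = xc%:~R + 1 + r ->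
  lin x1 x2 v = xc%:~R + l * (h - 1) ->
  lattice_width (triangle v a b) = Num.min h (1 + l + r).
Proof.
move=> det h1 l0 r0 lr Ya Yb Yv Xa Xb Xv.
have [Tv Ta Tb] := triangle_vertices v a b.
(* By [lr] the products [l * (h - 1)] and [r * (h - 1)] add up to 1, so the abscissa of the apex
   lies in [[0, 1]], over the base. *)
have lh : 0 <= l * (h - 1) by rewrite mulr_ge0; lra.
have rh : 0 <= r * (h - 1) by rewrite mulr_ge0; lra.
have wY : sup (image_lin y1 y2 (triangle v a b)) - inf (image_lin y1 y2 (triangle v a b)) = h.
  rewrite (image_lin_width Ta Tv Ya Yv); first by rewrite addrC addKr.
    by split; lra.
  by split; lra.
have wX : sup (image_lin x1 x2 (triangle v a b)) - inf (image_lin x1 x2 (triangle v a b)) = 1 + l + r.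
  rewrite (image_lin_width Ta Tb Xa Xb); first by ring.
    by split; lra.
  by split; lra.
have nz (p q : int) : (p = 0 -> q = 0 -> x1 * y2 - x2 * y1 = 0) -> (p, q) != (0, 0).
  move=> H; apply/eqP => -[p0 q0]; have {}H := H p0 q0.
  by case: det => E; rewrite E in H.
have lb : lbound [set d : R | exists u1 u2 : int, (u1, u2) != (0, 0) /\
     d = sup (image_lin u1 u2 (triangle v a b)) - inf (image_lin u1 u2 (triangle v a b))]
     (Num.min h (1 + l + r)).
  move=> _ [u1 [u2 [u0 ->]]].
  have [P [Q [E1 E2]]] : exists P Q : int, u1 = P * x1 + Q * y1 /\ u2 = P * x2 + Q * y2.
    case: det => det.
      exists (u1 * y2 - u2 * y1), (x1 * u2 - x2 * u1); split.
        by transitivity ((x1 * y2 - x2 * y1) * u1); [rewrite det mul1r|ring].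
      by transitivity ((x1 * y2 - x2 * y1) * u2); [rewrite det mul1r|ring].
    exists (- (u1 * y2 - u2 * y1)), (- (x1 * u2 - x2 * u1)); split.
      by transitivity (- (x1 * y2 - x2 * y1) * u1); [rewrite det opprK mul1r|ring].
    by transitivity (- (x1 * y2 - x2 * y1) * u2); [rewrite det opprK mul1r|ring].
  have linE x : lin u1 u2 x = P%:~R * lin x1 x2 x + Q%:~R * lin y1 y2 x.
    by rewrite /lin E1 E2 !intrD !intrM; ring.
  have int_ge1 (n : int) (y : R) : n != 0 -> 0 <= y -> y <= `|n%:~R * y|.
    move=> n0 y0; rewrite normrM (ger0_norm y0) -{1}[y]mul1r ler_wpM2r//.
    by rewrite -intr_norm ler1z -gtz0_ge1 normr_gt0.
  rewrite ge_min; have [P0|P0] := eqVneq P 0; apply/orP; [left|right].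
    have Q0 : Q != 0.
      by apply: contra_neq u0 => Q0; rewrite E1 E2 P0 Q0 !mul0r !addr0.
    apply: le_trans (image_lin_width_ge u1 u2 Tv Ta).
    rewrite !linE P0 !mul0r !add0r -mulrBr Yv Ya (_ : _ - _ = h); last by ring.
    by apply: int_ge1 => //; lra.
  apply: le_trans (image_lin_width_ge u1 u2 Tb Ta).
  rewrite !linE Ya Yb Xa Xb (_ : _ - _ = P%:~R * (1 + l + r)); last by ring.
  by apply: int_ge1 => //; lra.
apply/eqP; rewrite eq_le; apply/andP; split; last first.
  apply: lb_le_inf => //; exists h, y1, y2; split=> //.
  by apply: nz => -> ->; rewrite !mulr0 subr0.
rewrite le_min; apply/andP; split; apply: ge_inf; try by eexists; exact: lb.
  exists y1, y2; split => //.
  by apply: nz => -> ->; rewrite !mulr0 subr0.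
exists x1, x2; split => //.
by apply: nz => -> ->; rewrite !mul0r subr0.
Qed.

End LatticeWidth.

(** * The probability bound for triangles of type 2 *)

Section Type2Probability.
Context {R : realType}.
Implicit Types (a b v u w x f : R * R).
Local Notation T1 := (measurableTypeR R).

Definition good_split u v w (z : R) f := exists a1 a2 c : int,
  let th := lin a1 a2 f - c%:~R in
  [/\ gcdz a1 a2 = 1%N, 0 < th < 1 &
  [/\ split_coef_le th (lin a1 a2 u - c%:~R) z, split_coef_le th (lin a1 a2 v - c%:~R) z &
      split_coef_le th (lin a1 a2 w - c%:~R) z]].

Lemma good_split_rot u v w (z : R) f : good_split u v w z f -> good_split v w u z f.
Proof. by move=> [a1 [a2 [c [g1 th [? ? ?]]]]]; exists a1, a2, c. Qed.

Lemma good_split_strength u v w (z : R) f : orient u v w != 0 ->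
  interior (triangle u v w) f -> 1 < z -> good_split u v w z f ->
  (strength_at u v w f <= z%:E)%E.
Proof.
move=> D If z1 [a1 [a2 [c [g1 th [cu cv cw]]]]].
apply/(strength_leP D If (ltW z1)) => s Qs.
by rewrite !mulrDr; exact: (split_cut g1 th Qs cu cv cw).
Qed.

Lemma unimodular_gcd (x1 x2 y1 y2 : int) :
  x1 * y2 - x2 * y1 = 1 \/ x1 * y2 - x2 * y1 = -1 ->
  gcdz x1 x2 = 1%N /\ gcdz y1 y2 = 1%N.
Proof.
move=> det; suff H (p q s t : int) : s * p + t * q = 1 -> gcdz p q = 1%N.
  case: det => det; split.
  - by apply: (H _ _ y2 (- y1)); rewrite -det; ring.
  - by apply: (H _ _ (- x2) x1); rewrite -det; ring.
  - by apply: (H _ _ (- y2) y1); rewrite -[1]opprK -det; ring.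
  - by apply: (H _ _ x2 (- x1)); rewrite -[1]opprK -det; ring.
by move=> E; suff /eqP : coprimez p q by []; apply/coprimezP; exists (s, t).
Qed.

(** Both orientations change sign. This describes the left and right failing triangles by one
    definition. *)
Lemma bary_swap u v w x : bary u w v x = bary u v w x.
Proof.
rewrite /bary (_ : orient x w v = - orient x v w); last by rewrite /orient; ring.
by rewrite (_ : orient u w v = - orient u v w) ?invrN ?mulrNN//; rewrite /orient; ring.
Qed.

(** In the coordinates at [v] and [a], a right triangle with legs [c / p] and [c / q] when these are
    positive. *)
Definition corner_triangle v a b (t p q c : R) := [set x | [/\ t < bary v a b x,
  0 < bary a b v x & p * (bary v a b x - t) + q * bary a b v x < c]].

Lemma measurable_corner_triangle v a b (t p q c : R) : orient v a b != 0 ->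
  measurable (corner_triangle v a b t p q c : set (T1 * T1)).
Proof.
move=> D; have D1 := orient_rot_neq0 D.
have -> : corner_triangle v a b t p q c = [set x | t < bary v a b x] `&` [set x | 0 < bary a b v x]
  `&` [set x | p * (bary v a b x - t) + q * bary a b v x < c].
  by apply/seteqP; split => x /=; [move=> [? ? ?]|move=> [[? ?] ?]].
apply: measurableI; first by apply: measurableI; exact: measurable_bary_gt.
pose A1 := (a.2 - b.2) / orient v a b; pose B1 := (b.1 - a.1) / orient v a b.
pose C1 := (a.1 * b.2 - a.2 * b.1) / orient v a b.
pose A2 := (b.2 - v.2) / orient a b v; pose B2 := (v.1 - b.1) / orient a b v.
pose C2 := (b.1 * v.2 - b.2 * v.1) / orient a b v.
have := measurable_halfplane (- (p * A1 + q * A2)) (- (p * B1 + q * B2)) (c + p * t - (p * C1 + q * C2)).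
congr measurable; apply: eq_set => x.
rewrite !bary_affine// -/A1 -/B1 -/C1 -/A2 -/B2 -/C2 -[in RHS]subr_gt0; congr (0 < _); ring.
Qed.

Lemma area_corner_triangle v a b (t p q c : R) : orient v a b != 0 ->
  0 < p -> 0 < q -> 0 < c ->
  area (corner_triangle v a b t p q c) =
  (c ^+ 2 / (p * q) * (`|orient v a b| * simplex_area))%:E.
Proof.
move=> D p0 q0 c0.
pose A : set (T1 * T1) := [set x | [/\ t < x.1, 0 < x.2 & p * (x.1 - t) + q * (x.2 - 0) < c]].
have mA : measurable A.
  have -> : A = [set x | 0 < 1 * x.1 + 0 * x.2 + - t] `&` [set x | 0 < 0 * x.1 + 1 * x.2 + 0]
    `&` [set x | 0 < - p * x.1 + - q * x.2 + (c + p * t)].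
    by apply/seteqP; split => x /=; [move=> [? ? ?]; split; [split|]|move=> [[? ?] ?]; split]; lra.
  by do ?apply: measurableI; exact: measurable_halfplane.
have := area_bary D mA; rewrite area_right_triangle//.
rewrite -EFinM mulrCA => <-; congr area; apply: eq_set => x.
by rewrite /A /= subr0.
Qed.

(** The set measured by [probP] contains the interior minus [F], whose area is bounded below by
    subadditivity. *)
Lemma probP_ge u v w (z c : R) (F : set (T1 * T1)) : orient u v w != 0 -> 1 < z ->
  measurable F -> (area F <= (c * (`|orient u v w| * simplex_area))%:E)%E ->
  (forall f, interior (triangle u v w) f -> ~ F f -> good_split u v w z f) ->
  ((1 - c)%:E <= probP u v w z)%E.
Proof.
move=> D z1 mF aF good.
have D1 := orient_rot_neq0 D; have D2 := orient_rot_neq0 D1.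
pose A0 := `|orient u v w| * simplex_area (R := R).
have A00 : 0 < A0 by rewrite mulr_gt0 ?normr_gt0// simplex_area_gt0.
have mI : measurable (interior (triangle u v w) : set (T1 * T1)).
  have -> : interior (triangle u v w) = [set x | 0 < bary u v w x] `&` [set x | 0 < bary v w u x]
     `&` [set x | 0 < bary w u v x].
    apply/seteqP; split => x; first by move=> /(interior_triangleP _ D)[? ? ?].
    by move=> [[? ?] ?]; apply/(interior_triangleP _ D).
  by do ?apply: measurableI; exact: measurable_bary_gt.
pose S := [set f | interior (triangle u v w) f /\ (strength_at u v w f <= z%:E)%E].
have H : (((1 - c) * A0)%:E <= area S)%E.
  apply: (@le_trans _ _ (area (interior (triangle u v w) `\` F))); last first.
    apply: le_area => f [If nF]; split => //.
    by apply: good_split_strength => //; exact: good.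
  have : (area (interior (triangle u v w)) <= area (interior (triangle u v w) `\` F) + area F)%E.
    apply: (@le_trans _ _ (area ((interior (triangle u v w) `\` F) `|` F))).
      by apply: le_area => f If; have [|] := pselect (F f); [right|left].
    by apply: measureU2 => //; exact: measurableD.
  rewrite area_interior_triangle// -/A0 => le1.
  have : (A0%:E <= area (interior (triangle u v w) `\` F) + (c * A0)%:E)%E.
    by apply: (le_trans le1); rewrite leeD2l.
  by rewrite -leeBlDr// -EFinB mulrBl mul1r.
by rewrite /probP area_triangle//= -/A0 -/S lee_pdivlMr// -EFinM.
Qed.

(** For [l = 0] the triangle is empty and the formula gives 0; this covers a base end that is itself
    a lattice point. *)
Lemma area_failing v a b (t h L l e : R) : orient v a b != 0 ->
  0 < h -> 0 < L -> 0 < e -> 0 <= l ->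
  area (corner_triangle v a b t (l * h) L (l * e)) =
  (l * e ^+ 2 / (h * L) * (`|orient v a b| * simplex_area))%:E.
Proof.
move=> D h0 L0 e0; rewrite le_eqVlt => /orP[/eqP <-|l0].
  rewrite !mul0r (_ : corner_triangle _ _ _ _ _ _ _ = set0); first by rewrite /area measure0.
  by rewrite -subset0 => x [_ x0]; rewrite mul0r add0r => /= H; have := mulr_gt0 L0 x0; lra.
rewrite area_corner_triangle ?mulr_gt0//; congr (_ * _)%:E; field; lra.
Qed.

(** Here [v] is the apex, while [u1 u2 u3] keeps the given order of the vertices, on which [probP]
    is evaluated. *)
Lemma type2_probability v a b u1 u2 u3 (z w : R) : orient v a b != 0 -> type2_at v a b ->
  (forall x, is_lattice x -> ~ interior (triangle v a b) x) -> 1 < z ->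
  orient u1 u2 u3 = orient v a b -> triangle u1 u2 u3 = triangle v a b ->
  (forall f, good_split v a b z f -> good_split u1 u2 u3 z f) ->
  w = lattice_width (triangle u1 u2 u3) ->
  ((if z <= w then 0
    else if z <= w / (w - 1) then (z - w) * (2 * w * z - w - z) / (w ^+ 2 * (z - 1) ^+ 2)
    else (z - w) * (2 * w * z - w - z) / (w ^+ 2 * (z - 1) ^+ 2) +
         ((w - 1) ^+ 2 * (z - 1) ^+ 2 - 1) / (w ^+ 2 * (z - 1) ^+ 2))%:E
   <= probP u1 u2 u3 z)%E.
Proof.
move=> D T2 free z1 oE tE gE wdef.
have D1 := orient_rot_neq0 D; have D2 := orient_rot_neq0 D1.
have D' : orient v b a != 0.
  by rewrite (_ : orient v b a = - orient v a b) ?oppr_eq0// /orient; ring.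
have Du : orient u1 u2 u3 != 0 by rewrite oE.
have [x1 [x2 [xc [y1 [y2 [yc [h [l [r]]]]]]]]] := type2_normal_form D T2 free.
move=> [[det h1 l0 r0 lr] [[Ya Yb Yv] [Xa Xb Xv]]].
have wE : w = Num.min h (1 + l + r).
  by rewrite wdef tE; exact: (lattice_width_unimodular det h1 l0 r0 lr Ya Yb Yv Xa Xb Xv).
have [gx gy] := unimodular_gcd det.
set L := 1 + l + r in wE.
pose Z := z - 1.
have Z0 : 0 < Z by rewrite /Z; lra.
have h0 : 0 < h - 1 by lra.
have hp : 0 < h by lra.
have L0 : 0 < L by rewrite /L; lra.
have lrE : l + r = (h - 1)^-1 by apply: (mulIf (lt0r_neq0 h0)); rewrite lr mulVf// gt_eqF.
have LE : L = h / (h - 1) by rewrite /L -addrA lrE; field; lra.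
pose X f := lin x1 x2 f - xc%:~R; pose Y f := lin y1 y2 f - yc%:~R.
have YE f : Y f = bary v a b f * h.
  have S := bary_sum f D; have : (bary v a b f + bary a b v f + bary b v a f) * yc%:~R = yc%:~R :> R by rewrite S mul1r.
  by rewrite /Y (lin_bary y1 y2 f D) Ya Yb Yv; lra.
have XE f : X f = l * h * bary v a b f + L * bary b v a f - l.
  have S := bary_sum f D; have : (bary v a b f + bary a b v f + bary b v a f) * xc%:~R = xc%:~R :> R by rewrite S mul1r.
  have : (bary v a b f + bary a b v f + bary b v a f) * l = l by rewrite S mul1r.
  by rewrite /X /L (lin_bary x1 x2 f D) Xa Xb Xv; lra.
have XE' f : 1 - X f = r * h * bary v a b f + L * bary a b v f - r.
  rewrite XE /L; have S := bary_sum f D.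
  have : (bary v a b f + bary a b v f + bary b v a f) * (1 + l + r) = 1 + l + r by rewrite S mul1r.
  have : (l + r) * h * bary v a b f = (1 + (l + r)) * bary v a b f by congr (_ * _); lra.
  lra.
(* The base vertices are at position 0 and only need the coefficient 1, so the apex, at position
   [h], gives the only condition. *)
have goodY f : 0 < Y f -> h - 1 <= Z * (1 - Y f) -> good_split v a b z f.
  move=> Y0 HY; exists y1, y2, yc; rewrite -/(Y f) Ya Yb Yv subrr [_ + h]addrC addrK.
  have Y1 : Y f < 1 by rewrite -subr_gt0 -(pmulr_rgt0 _ Z0); lra.
  have ZY : 0 <= Z * Y f by rewrite mulr_ge0// ltW.
  by split => //; [apply/andP; split; lra|]; split; split; rewrite /Z in HY ZY; lra.
(* The apex lies inside this split; the base vertices, at [- l] and [1 + r], give the two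
   conditions. *)
have goodX f : 0 < X f -> X f < 1 -> l <= Z * X f -> r <= Z * (1 - X f) -> good_split v a b z f.
  move=> X0 X1 HX HX'; exists x1, x2, xc; rewrite -/(X f) Xa Xb Xv.
  have -> : xc%:~R - l - xc%:~R = - l by ring.
  have -> : xc%:~R + 1 + r - xc%:~R = 1 + r by ring.
  have -> : xc%:~R + l * (h - 1) - xc%:~R = l * (h - 1) by ring.
  have lh : 0 <= l * (h - 1) by rewrite mulr_ge0// ltW.
  have rh : 0 <= r * (h - 1) by rewrite mulr_ge0// ltW.
  have ZX : 0 <= Z * X f by rewrite mulr_ge0// ltW.
  have ZX' : 0 <= Z * (1 - X f) by rewrite mulr_ge0//; lra.
  by split => //; [apply/andP; split; lra|]; split; split; rewrite /Z in HX HX' ZX ZX'; lra.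
(* for [e = 1 + 1 / (z - 1) - t * h]: the points of height above [t * h] with
   [X < l / (z - 1)], resp. [1 - X < r / (z - 1)] *)
pose Fl t e := corner_triangle v b a t (l * h) L (l * e).
pose Fr t e := corner_triangle v a b t (r * h) L (r * e).
have mFl t e : measurable (Fl t e : set (T1 * T1)).
  exact: measurable_corner_triangle.
have mFr t e : measurable (Fr t e : set (T1 * T1)).
  exact: measurable_corner_triangle.
have aF t e : 0 < e -> (area (Fl t e `|` Fr t e) <=
    (e ^+ 2 / h ^+ 2 * (`|orient u1 u2 u3| * simplex_area))%:E)%E.
  move=> e0; apply: (@le_trans _ _ (area (Fl t e) + area (Fr t e))%E); first exact: measureU2.
  rewrite /Fl /Fr !area_failing//.
  rewrite (_ : `|orient v b a| = `|orient v a b|); last first.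
    by rewrite -normrN; congr (`|_|); rewrite /orient; ring.
  (* The two areas add up nicely because [(l + r) / (h * L) = 1 / h ^+ 2]. *)
  rewrite oE -EFinD -mulrDl lee_fin -!mulrDl lrE LE.
  by rewrite [leLHS](_ : _ = e ^+ 2 / h ^+ 2 * (`|orient v a b| * simplex_area))//; congr (_ * _); field; lra.
have inF t f : interior (triangle v a b) f -> t < bary v a b f ->
    ~ (Fl t (1 + Z^-1 - t * h) `|` Fr t (1 + Z^-1 - t * h)) f -> good_split v a b z f.
  move=> /(interior_triangleP _ D)[f1 f2 f3] tf nF.
  have Zi : Z * Z^-1 = 1 by rewrite mulfV// gt_eqF.
  have hl : l <= Z * X f.
    rewrite leNgt; apply/negP => H; apply: nF; left.
    rewrite /Fl /corner_triangle /= (bary_swap v a b) (bary_swap b v a); split => //.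
    rewrite -(ltr_pM2l Z0); have := XE f => E; rewrite E in H.
    have : l * (Z * Z^-1) = l by rewrite Zi mulr1.
    lra.
  have hr : r <= Z * (1 - X f).
    rewrite leNgt; apply/negP => H; apply: nF; right; split => //.
    rewrite -(ltr_pM2l Z0); have := XE' f => E; rewrite E in H.
    have : r * (Z * Z^-1) = r by rewrite Zi mulr1.
    lra.
  have X0 : 0 < X f.
    (* For [l = 0] the inequality [hl] is not strict enough, and positivity comes from the
       coordinate at [b]. *)
    have [l00|l00] := eqVneq l 0; first by rewrite XE l00 !mul0r add0r subr0 mulr_gt0.
    by rewrite -(pmulr_rgt0 _ Z0); apply: lt_le_trans hl; rewrite lt_neqAle eq_sym l00.
  have X1 : X f < 1.
    rewrite -subr_gt0; have [r00|r00] := eqVneq r 0; first by rewrite XE' r00 !mul0r add0r subr0 mulr_gt0.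
    by rewrite -(pmulr_rgt0 _ Z0); apply: lt_le_trans hr; rewrite lt_neqAle eq_sym r00.
  exact: goodX.
have w1 : 1 < w by rewrite wE lt_min h1 /L -addrA lrE ltrDl invr_gt0.
case: ifPn => [_|]; last rewrite -ltNge => wz.
  apply: mule_ge0; first exact: measure_ge0.
  by rewrite lee_fin invr_ge0; apply: fine_ge0; exact: measure_ge0.
(* The coordinate at the apex for which the condition in [goodY] becomes an equality. *)
pose tau := (1 - (h - 1) / Z) / h.
have tauE : tau * h = 1 - (h - 1) / Z by rewrite /tau divfK// gt_eqF//; lra.
have goodtau f : interior (triangle v a b) f -> bary v a b f <= tau -> good_split v a b z f.
  move=> /(interior_triangleP _ D)[f1 f2 f3] ft; apply: goodY.
    by rewrite YE mulr_gt0//; lra.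
  have : bary v a b f * h <= tau * h by rewrite ler_pM2r//; lra.
  rewrite -YE tauE => H.
  have : Z * ((h - 1) / Z) <= Z * (1 - Y f) by rewrite ler_pM2l//; lra.
  by rewrite mulrCA mulfV ?mulr1// gt_eqF.
case: ifPn => [_|]; last rewrite -ltNge => wz2.
  (* Since [(h - 1) * (L - 1) = 1], [w / (w - 1)] is the larger of [h] and [L]. Up to this value
     only the split in the direction attaining the width is used. *)
  have [hL|Lh] := leP h L.
    have wh : w = h by rewrite wE; apply/min_idPl.
    have tau1 : tau < 1.
      rewrite /tau ltr_pdivrMr ?mul1r; last lra.
      have : 0 < (h - 1) / Z by rewrite divr_gt0.
      lra.
    have -> : (z - w) * (2 * w * z - w - z) / (w ^+ 2 * (z - 1) ^+ 2) = 1 - (1 - tau) ^+ 2.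
      by rewrite wh /tau /Z; field; lra.
    apply: (@probP_ge _ _ _ _ _ [set x | [/\ tau < bary v a b x, 0 < bary a b v x & 0 < bary b v a x]]) => //.
    - have -> : [set x | [/\ tau < bary v a b x, 0 < bary a b v x & 0 < bary b v a x]] =
         [set x | tau < bary v a b x] `&` [set x | 0 < bary a b v x] `&` [set x | 0 < bary b v a x].
        by apply/seteqP; split => x /=; [move=> [? ? ?]|move=> [[? ?] ?]].
      by do ?apply: measurableI; exact: measurable_bary_gt.
    - rewrite oE (area_corner D tau1)//; first by rewrite lee_fin -mulrA mulrCA.
      by move=> x [? ? ?]; split; exact: ltW.
    - rewrite tE => f If nF; apply: gE; apply: goodtau => //; rewrite leNgt; apply/negP => ft.
      by apply: nF; have /(interior_triangleP _ D)[] := If.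
  have wL : w = L by rewrite wE; apply/min_idPr; exact: ltW.
  have -> : (z - w) * (2 * w * z - w - z) / (w ^+ 2 * (z - 1) ^+ 2) =
      1 - (1 + Z^-1 - 0 * h) ^+ 2 / h ^+ 2.
    by rewrite wL LE /Z; field; lra.
  have e0 : 0 < 1 + Z^-1 - 0 * h.
    have : 0 < Z^-1 by rewrite invr_gt0.
    lra.
  apply: (@probP_ge _ _ _ _ _ (Fl 0 (1 + Z^-1 - 0 * h) `|` Fr 0 (1 + Z^-1 - 0 * h))) => //.
  - exact: measurableU.
  - exact: aF.
  - rewrite tE => f If nF; apply: gE; apply: (inF 0) => //.
    by have /(interior_triangleP _ D)[] := If.
(* Both splits together give [1 - 1 / Z ^+ 2], because [1 + Z^-1 - tau * h = h / Z]. This exceeds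
   the claimed bound by [2 * (w - 1) * ((w - 1) * Z - 1) / (w ^+ 2 * Z ^+ 2)], which is positive
   here. *)
apply: (@le_trans _ _ (1 - (1 + Z^-1 - tau * h) ^+ 2 / h ^+ 2)%:E).
  have -> : 1 - (1 + Z^-1 - tau * h) ^+ 2 / h ^+ 2 = (w ^+ 2 * Z ^+ 2 - w ^+ 2) / (w ^+ 2 * Z ^+ 2).
    by rewrite tauE; field; do ?[apply/andP; split]; lra.
  rewrite lee_fin -/Z -mulrDl ler_pM2r; last by rewrite invr_gt0 mulr_gt0// exprn_gt0//; lra.
  have H : 1 < (w - 1) * Z.
    by move: wz2; rewrite ltr_pdivrMr /Z; lra.
  have : 0 < (w - 1) * ((w - 1) * Z - 1) by rewrite mulr_gt0//; lra.
  rewrite /Z; lra.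
have e0 : 0 < 1 + Z^-1 - tau * h.
  rewrite (_ : _ - _ = h / Z); first by rewrite divr_gt0//; lra.
  by rewrite tauE; field; lra.
apply: (@probP_ge _ _ _ _ _ (Fl tau (1 + Z^-1 - tau * h) `|` Fr tau (1 + Z^-1 - tau * h))) => //.
- exact: measurableU.
- exact: aF.
- rewrite tE => f If nF; apply: gE; have [|ft] := leP (bary v a b f) tau; first exact: goodtau.
  exact: (inF tau).
Qed.

End Type2Probability.

Theorem theorem1 (R : realType) (v1 v2 v3 u1 u2 u3 : R * R) :
  type1 v1 v2 v3 -> maximal_lattice_free (triangle v1 v2 v3) ->
  type2 u1 u2 u3 -> rational_triangle u1 u2 u3 ->
  maximal_lattice_free (triangle u1 u2 u3) ->
  let w := lattice_width (triangle u1 u2 u3) in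
  forall z : R, 1 < z ->
    (probP v1 v2 v3 z =
       (if z <= 3 / 2 then 0
        else if z < 2 then 3 / 4 * ((2 * z - 3) / (z - 1)) ^+ 2
        else 1)%:E)
    /\
    (let g1 := (z - w) * (2 * w * z - w - z) / (w ^+ 2 * (z - 1) ^+ 2) in
     let g2 := ((w - 1) ^+ 2 * (z - 1) ^+ 2 - 1) / (w ^+ 2 * (z - 1) ^+ 2) in
     ((if z <= w then 0
       else if z <= w / (w - 1) then g1
       else g1 + g2)%:E <= probP u1 u2 u3 z)%E).
Proof.
move=> [D lv1 lv2 lv3 [e12 e23 e31]] [[_ [_ [_ free1]]] _].
move=> [D2 t2] _ [[_ [_ [_ free2]]] _] w z z1; split.
  by apply: type1_probability.
have D23 : orient u2 u3 u1 != 0 by exact: orient_rot_neq0.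
have D31 : orient u3 u1 u2 != 0 by exact: orient_rot_neq0.
(* The three positions of the apex differ by a rotation of the vertices. *)
case: t2 => [|[|]] t2.
- exact: (type2_probability D2 t2 free2 z1).
- apply: (type2_probability D23 t2 _ z1) => //.
  + by rewrite -triangle_rot.
  + by rewrite (orient_rot u1 u2 u3).
  + exact: triangle_rot.
  + by move=> f /good_split_rot/good_split_rot.
- apply: (type2_probability D31 t2 _ z1) => //.
  + by rewrite triangle_rot.
  + exact: orient_rot.
  + exact/esym/triangle_rot.
  + by move=> f /good_split_rot.
Qed.
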